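(* Let $n\geq 2$ be an integer and let $G_\mathbb{R}^+(2,n)$ be the Grassmannian of oriented $2$-planes in $\mathbb{R}^n$, equipped with the natural action of a maximal torus $T$ of $\mathrm{SO}_n$. Then the orbit space $G_\mathbb{R}^+(2,n)/T$ is homeomorphic to the topological join \[S^{\lfloor n/2 \rfloor-1} \ast \mathbb{P}_\mathbb{C}^{\lceil n/2 \rceil-2}.\]
   Context: $G_\mathbb{R}^+(2,n)=\{(v_1,v_2)\in\mathbb{R}^{n\times 2}\mid \langle v_i,v_j\rangle=\delta_{ij}\}/\mathrm{SO}_2$, where $\mathrm{SO}_2$ acts by right multiplication; $\mathrm{SO}_n$ acts by $A\cdot(v_1,v_2)=(Av_1,Av_2)$. A maximal torus $T\cong (S^1)^{\lfloor n/2\rfloor}$ of $\mathrm{SO}_n$ is given by the block-diagonal matrices $\mathrm{diag}(Q_{\phi_1},\dots,Q_{\phi_k})$ for $n=2k$ and $\mathrm{diag}(Q_{\phi_1},\dots,Q_{\phi_k},1)$ for $n=2k+1$, where $Q_\phi=\begin{pmatrix}\cos\phi&-\sin\phi\\ \sin\phi&\cos\phi\end{pmatrix}$. The join $A\ast B$ is $(A\times B\times[0,1])/\sim$ with $(a,b,0)\sim(a',b,0)$ and $(a,b,1)\sim(a,b',1)$; by convention $\mathbb{P}^{-1}_\mathbb{C}=\emptyset$ and $A\ast\emptyset=A$. *)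

(* Defs.v *)
From HB Require Import structures.
From mathcomp Require Import all_boot all_order all_algebra.
From mathcomp Require Import all_classical all_reals all_analysis.
Set Implicit Arguments. Unset Strict Implicit. Unset Printing Implicit Defensive.
Import Order.TTheory GRing.Theory Num.Theory.
Import numFieldNormedType.Exports.
Local Open Scope classical_set_scope.
Local Open Scope ring_scope.

Section Kernel.
Context {T : choiceType} {U : Type} (f : T -> U).
Definition kerrel : rel T := fun x y => `[< f x = f y >].
Lemma kerrel_equiv : equiv_class_of kerrel.
Proof.
split.
- by move=> x; apply/asboolP.
- by move=> x y; apply/asboolP/asboolP.
- by move=> y x z /asboolP Hxy /asboolP Hyz; apply/asboolP; rewrite Hxy.
Qed.
Definition kerequiv : equiv_rel T := EquivRelPack kerrel_equiv.
End Kernel.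

(* Quotient space of T (quotient topology) by the equivalence relation
   identifying x and y iff cls x = cls y.  Typically cls x is the
   equivalence class (orbit) of x. *)
Definition quot_by {T : topologicalType} (U : Type) (cls : T -> U)
  : topologicalType :=
  quotient_topology ({eq_quot kerequiv cls}%qT).

Definition qpi {T : topologicalType} (U : Type) (cls : T -> U) : T -> quot_by cls :=
  \pi%qT.

Definition homeomorphic (X Y : topologicalType) : Prop :=
  exists (f : X -> Y) (g : Y -> X),
    [/\ cancel f g, cancel g f, continuous f & continuous g].

Section Grass.
Variables (R : realType) (n : nat).

Definition stiefel : set 'M[R]_(n, 2) := [set V | V^T *m V = 1%:M].
Definition Stiefel : topologicalType := set_type stiefel.

Definition SO2 : set 'M[R]_2 := [set A | A^T *m A = 1%:M /\ \det A = 1].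

Definition so2_orbit (V : Stiefel) : set Stiefel :=
  [set W | exists2 A, SO2 A & set_val W = set_val V *m A].

Definition Grass2 : topologicalType := quot_by so2_orbit.

(* entries of Q_phi, indexed by (row parity, column parity) *)
Definition rot_entry (phi : R) (a b : bool) : R :=
  match a, b with
  | false, false => cos phi
  | false, true => - sin phi
  | true, false => sin phi
  | true, true => cos phi
  end.

(* diag(Q_{phi_1},...,Q_{phi_k}) (n = 2k) or diag(Q_{phi_1},...,Q_{phi_k},1)
   (n = 2k+1); only phi 0, ..., phi (k-1) are used. *)
Definition torus_mx (phi : nat -> R) : 'M[R]_n :=
  \matrix_(i < n, j < n)
    if ((i < 2 * n./2)%N && (i./2 == j./2)%N)
    then rot_entry (phi i./2) (odd i) (odd j)
    else (i == j)%:R.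

Definition torus : set 'M[R]_n := [set torus_mx phi | phi in [set: nat -> R]].

Definition torus_orbit (x : Grass2) : set Grass2 :=
  [set y | exists2 A, torus A &
     exists V W : Stiefel, [/\ qpi so2_orbit V = x, qpi so2_orbit W = y &
                               set_val W = A *m set_val V]].

Definition Grass2_mod_T : topologicalType := quot_by torus_orbit.
End Grass.

(* unit_sphere R k = S^(k-1), the unit sphere of R^k *)
Definition unit_sphere (R : realType) (k : nat) : topologicalType :=
  set_type [set x : 'rV[R]_k | \sum_(i < k) x ord0 i ^+ 2 = 1].

(* C^N \ {0}, a complex vector being encoded by (real part, imaginary part) *)
Definition cnz (R : realType) (N : nat) : topologicalType :=
  set_type [set z : 'rV[R]_N * 'rV[R]_N | z != (0, 0)].

(* orbit of z under multiplication by nonzero complex scalars a + i b *)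
Definition cstar_orbit (R : realType) (N : nat) (z : cnz R N) : set (cnz R N) :=
  [set w | exists a b : R, (a != 0 \/ b != 0) /\
     set_val w = (a *: (set_val z).1 - b *: (set_val z).2,
                  a *: (set_val z).2 + b *: (set_val z).1)].

(* proj_space R N = P(C^N) = P^(N-1)_C *)
Definition proj_space (R : realType) (N : nat) : topologicalType :=
  quot_by (@cstar_orbit R N).

Definition unit_interval (R : realType) : topologicalType :=
  set_type [set t : R | 0 <= t <= 1].

Definition join_class (R : realType) (A B : topologicalType)
  (p : (A * B) * unit_interval R) : set ((A * B) * unit_interval R) :=
  if set_val p.2 == 0 then [set q | q.1.2 = p.1.2 /\ set_val q.2 = 0]
  else if set_val p.2 == 1 then [set q | q.1.1 = p.1.1 /\ set_val q.2 = 1]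
  else [set p].

(* the topological join A * B (for B nonempty) *)
Definition join (R : realType) (A B : topologicalType) : topologicalType :=
  quot_by (@join_class R A B).

(* Main.v *)
Require Import Defs.
From HB Require Import structures.
From mathcomp Require Import all_boot all_order all_algebra.
From mathcomp Require Import all_classical all_reals all_analysis.
From mathcomp Require Import ring lra zify.
Set Implicit Arguments.
Unset Strict Implicit.
Unset Printing Implicit Defensive.
Import Order.TTheory GRing.Theory Num.Theory.
Import numFieldNormedType.Exports.
Local Open Scope classical_set_scope.
Local Open Scope ring_scope.

(** Write an orthonormal 2-frame as a vector [z = x + i y] of C^n with
    [sum z_i^2 = 0] and [sum |z_i|^2 = 2].  Each coordinate block (z, z') of the
    torus contributes the invariants [d = det] (real) and [p = z^2 + z'^2]
    (complex); since [|z|^2 + |z'|^2 = sqrt (|p|^2 + 4 d^2)], the pair (d, p)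
    determines the Gram matrix of the block, hence the block up to rotation.
    When n is odd the last coordinate gives one more [p = z^2], which forgets
    only a sign, and that sign is absorbed by - 1 in SO_2 composed with the
    rotation by pi in every block.  SO_2 multiplies all the p's by a common
    phase, and the sole linear relation is [sum p = 0].  So the orbit space is
    the set of rays of R^k x C^m (k = floor (n/2), m = ceil (n/2) - 1) modulo a
    phase on C^m, that is the join of S^(k-1) and P(C^m).

    Both spaces are compact and are embedded in the same Euclidean space by
    (d, p p^* ), normalized by |d|^2 + |p|^2 = 1. *)

(** * Compactness of subspaces and quotients, and a criterion for homeomorphism *)

Lemma compact_set_type (X : topologicalType) (A B : set X) :
  compact B -> B `<=` A -> compact (set_val @^-1` B : set (set_type A)).
Proof.
move=> cB BA F PF FB.
have [|p [Bp clp]] := cB (set_val @ F); first exact: FB.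
have Ap : p \in A by rewrite inE; exact: BA.
exists (SigSub Ap); split => //.
move=> U V FU [W [[W' oW' <-] Wp WV]].
have [] := clp (set_val @` U) W'.
- by rewrite /fmap /=; apply: filterS FU => x Ux; exists x.
- by apply: open_nbhs_nbhs; split.
- by move=> _ [[x Ux <-] Wx]; exists x; split => //; exact: WV.
Qed.

Lemma continuous_mx (T U : topologicalType) m n (f : T -> 'M[U]_(m, n)) :
  (forall i j, continuous (fun x => f x i j)) -> continuous f.
Proof.
move=> cf x A [P Px PA].
have : \forall y \near x, forall ij : 'I_m * 'I_n, P ij.1 ij.2 (f y ij.1 ij.2).
  by apply: filter_forall => -[i j]; exact: cf.
by apply: filterS => y Py; apply: PA => i j; exact: Py (i, j).
Qed.

Section quot_by.
Variables (T : topologicalType) (U : Type) (cls : T -> U).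

Lemma eq_qpi (x y : T) : qpi cls x = qpi cls y <-> cls x = cls y.
Proof.
have P : reflect (qpi cls x = qpi cls y) (kerequiv cls x y) := eqmodP _ _ _.
by split => [/P/asboolP|/asboolP/P].
Qed.

Lemma qpi_surj (q : quot_by cls) : exists x, qpi cls x = q.
Proof. by exists (repr q); exact: reprK. Qed.

Lemma continuous_qpi : continuous (qpi cls).
Proof. exact: pi_continuous. Qed.

(** It suffices that a compact [K] meets every class. This serves for projective space, where the
    total space is not compact but its unit sphere is. *)
Lemma compact_quot_by (K : set T) :
  compact K -> (forall x, exists2 y, K y & cls y = cls x) ->
  compact [set: quot_by cls].
Proof.
move=> cK Kcls.
suff -> : [set: quot_by cls] = qpi cls @` K.
  by apply: continuous_compact cK; apply: continuous_subspaceT; exact: continuous_qpi.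
rewrite eqEsubset; split => // q _; have [x <-] := qpi_surj q.
by have [y Ky yx] := Kcls x; exists y => //; apply/eq_qpi.
Qed.

Definition quot_lift (Z : Type) (f : T -> Z) (q : quot_by cls) : Z := f (repr q).

Lemma quot_liftE (Z : Type) (f : T -> Z) (x : T) :
  (forall x y, cls x = cls y -> f x = f y) -> quot_lift f (qpi cls x) = f x.
Proof. by move=> fP; apply: fP; apply/eq_qpi; exact: reprK. Qed.

Lemma continuous_quot_lift (Z : topologicalType) (f : T -> Z) :
  (forall x y, cls x = cls y -> f x = f y) -> continuous f ->
  continuous (quot_lift f).
Proof.
move=> fP cf; apply/quotient_continuous.
suff -> : quot_lift f \o \pi_(quot_by cls)%qT = f by [].
by apply/funext => x; exact: quot_liftE.
Qed.

End quot_by.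

(** [quot_by] compares classes as sets. When [cls] is the kernel relation of an invariant [f], this
    turns equality of classes into equality of invariants. *)
Lemma cls_eqP (T Z : Type) (cls : T -> set T) (f : T -> Z) :
  (forall x y, cls x y <-> f x = f y) ->
  forall x y, cls x = cls y <-> f x = f y.
Proof.
move=> clsP x y; split => [e|e].
  by apply/clsP; rewrite e; apply/clsP.
by apply/seteqP; split => z /clsP h; apply/clsP; rewrite -?e// e.
Qed.

Lemma compact_hausdorff_lift (X Y Z : topologicalType) (F : X -> Z) (G : Y -> Z) :
  compact [set: Y] -> hausdorff_space Z -> continuous F -> continuous G ->
  injective G -> (forall x, exists y, G y = F x) ->
  exists2 f : X -> Y, continuous f & forall x, G (f x) = F x.
Proof.
move=> cY hZ cF cG injG FG; have /choice[f fP] := FG.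
exists f => //; apply/continuous_closedP => C clC.
have -> : f @^-1` C = F @^-1` (G @` C).
  rewrite eqEsubset; split => x /= => [Cfx|[y Cy]]; first by exists (f x).
  by rewrite -fP => /injG <-.
apply: (continuous_closedP F).1 => //; apply: compact_closed => //.
apply: continuous_compact; first exact: continuous_subspaceT.
by apply: subclosed_compact cY _.
Qed.

(** The two families embed [X] and [Y] onto the same subset of the product [K^I]. Lifting each
    embedding through the other gives two continuous maps, which are mutually inverse because the
    invariants separate points. *)
Lemma homeomorphic_of_invariants (K : topologicalType) (I : eqType)
    (X Y : topologicalType) (F : I -> X -> K) (G : I -> Y -> K) :
  hausdorff_space K ->
  compact [set: X] -> compact [set: Y] ->
  (forall i, continuous (F i)) -> (forall i, continuous (G i)) ->
  (forall x x', (forall i, F i x = F i x') -> x = x') ->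
  (forall y y', (forall i, G i y = G i y') -> y = y') ->
  (forall x, exists y, forall i, G i y = F i x) ->
  (forall y, exists x, forall i, F i x = G i y) ->
  homeomorphic X Y.
Proof.
move=> hK cX cY cF cG injF injG FG GF.
pose Z : topologicalType := prod_topology (fun _ : I => K).
have hZ : hausdorff_space Z by apply: hausdorff_product.
have cvgZ (W : topologicalType) (H : I -> W -> K) :
    (forall i, continuous (H i)) -> continuous (fun w => (fun i => H i w) : Z).
  (* The product topology is the supremum of the initial topologies of the projections, so
     continuity is checked one coordinate at a time. *)
  move=> cH w; apply/cvg_sup => i.
  have : continuous (fun w => (fun j => H j w) : initial_topology (fun z : Z => z i)).
    by apply: continuous_comp_initial; exact: cH.
  exact.
have [||||f cf fP] := @compact_hausdorff_lift X Y Z (fun x i => F i x) (fun y i => G i y) cY hZ.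
- exact: cvgZ.
- exact: cvgZ.
- by move=> y y' e; apply: injG => i; exact: (congr1 (@^~ i) e).
- by move=> x; have [y yP] := FG x; exists y; apply/funext.
have [||||g cg gP] := @compact_hausdorff_lift Y X Z (fun y i => G i y) (fun x i => F i x) cX hZ.
- exact: cvgZ.
- exact: cvgZ.
- by move=> y y' e; apply: injF => i; exact: (congr1 (@^~ i) e).
- by move=> y; have [x xP] := GF y; exists x; apply/funext.
exists f, g; split => // [x|y].
- apply: injF => i; rewrite (congr1 (@^~ i) (gP (f x))).
  exact: (congr1 (@^~ i) (fP x)).
- apply: injG => i; rewrite (congr1 (@^~ i) (fP (g y))).
  exact: (congr1 (@^~ i) (gP y)).
Qed.

(** * Plane rotations and phases *)

Section planar.
Variable R : realType.
Implicit Types c s : R.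

Lemma unit_circle_angle c s : c ^+ 2 + s ^+ 2 = 1 ->
  exists phi, cos phi = c /\ sin phi = s.
Proof.
move=> cs1.
have c1 : -1 <= c <= 1.
  by have s2 := sqr_ge0 s; apply/andP; split; nra.
have c1' : c \in `[-1, 1] by rewrite in_itv.
have ss : Num.sqrt (1 - c ^+ 2) = `|s|.
  by rewrite -sqrtr_sqr; congr Num.sqrt; rewrite -cs1; ring.
have [s0|s0] := leP 0 s.
- by exists (acos c); rewrite acosK// sin_acos// ss ger0_norm.
- exists (- acos c); rewrite cosN sinN acosK// sin_acos// ss ltr0_norm//.
  by rewrite opprK.
Qed.

(** With [z = x + 'i y], the hypotheses say that the rank-one Hermitian matrices [z z^*] and
    [z' z'^*] coincide. The phase is the quotient [z' j / z j] at any index where [z j] is nonzero;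
    if there is none, both vectors vanish and the phase 1 works. *)
Lemma unit_rotation_exists (I : Type) (x y x' y' : I -> R) :
  (forall i j, x i * x j + y i * y j = x' i * x' j + y' i * y' j) ->
  (forall i j, y i * x j - x i * y j = y' i * x' j - x' i * y' j) ->
  exists c s, c ^+ 2 + s ^+ 2 = 1 /\
    forall i, x' i = c * x i - s * y i /\ y' i = s * x i + c * y i.
Proof.
move=> re im.
have [[j j0]|/forallNP z0] := pselect (exists j, x j * x j + y j * y j != 0).
  pose D := x j * x j + y j * y j.
  exists ((x' j * x j + y' j * y j) / D), ((y' j * x j - x' j * y j) / D).
  have D0 : D != 0 := j0.
  have DE : D = x' j * x' j + y' j * y' j by rewrite /D re.
  split.
    transitivity ((x' j * x' j + y' j * y' j) / D); last by rewrite -DE divff.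
    by rewrite /D; field.
  move=> i; split; apply: (mulfI D0).
    transitivity (x' j * (x i * x j + y i * y j) - y' j * (y i * x j - x i * y j)).
      by rewrite re im DE; ring.
    by rewrite /D; field.
  transitivity (x' j * (y i * x j - x i * y j) + y' j * (x i * x j + y i * y j)).
    by rewrite re im DE; ring.
  by rewrite /D; field.
have sq0 (a b : R) : a * a + b * b = 0 -> a = 0 /\ b = 0.
  move=> ab0; have := sqr_ge0 a; have := sqr_ge0 b => b2 a2.
  by split; apply/eqP; rewrite -sqrf_eq0; apply/eqP; nra.
exists 1, 0; split; first by ring.
move=> i; have /negP/negPn/eqP e := z0 i.
have [-> ->] := sq0 _ _ e; rewrite re in e; have [-> ->] := sq0 _ _ e.
by split; ring.
Qed.

End planar.

(** * Invariants of one coordinate block *)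

Section blocks.
Variable R : realType.
Implicit Types (x y : nat -> R) (j : nat).

(* With [z i = x i + 'i * y i], the complex number
   [z (2j) ^+ 2 + z (2j+1) ^+ 2] is [sqr_re x y j + 'i * sqr_im x y j]. *)
Definition sqr_re x y j : R :=
  x j.*2 ^+ 2 - y j.*2 ^+ 2 + (x j.*2.+1 ^+ 2 - y j.*2.+1 ^+ 2).
Definition sqr_im x y j : R :=
  2 * (x j.*2 * y j.*2 + x j.*2.+1 * y j.*2.+1).
Definition blk_det x y j : R := x j.*2 * y j.*2.+1 - x j.*2.+1 * y j.*2.
Definition blk_norm x y j : R :=
  x j.*2 ^+ 2 + y j.*2 ^+ 2 + (x j.*2.+1 ^+ 2 + y j.*2.+1 ^+ 2).

Lemma blk_norm_ge0 x y j : 0 <= blk_norm x y j.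
Proof. by rewrite !addr_ge0 ?sqr_ge0. Qed.

Lemma blk_normE x y j : blk_norm x y j =
  Num.sqrt (sqr_re x y j ^+ 2 + sqr_im x y j ^+ 2 + 4 * blk_det x y j ^+ 2).
Proof.
rewrite -[LHS]ger0_norm ?blk_norm_ge0// -sqrtr_sqr; congr Num.sqrt.
by rewrite /blk_norm /sqr_re /sqr_im /blk_det; ring.
Qed.

(** The invariants fix the norm of the block, hence the lengths, inner product and determinant of
    the two planar vectors formed by its columns. Reading these vectors as complex numbers reduces
    the claim to [unit_rotation_exists]. *)
Lemma block_rotation x y x' y' j :
  sqr_re x y j = sqr_re x' y' j -> sqr_im x y j = sqr_im x' y' j ->
  blk_det x y j = blk_det x' y' j ->
  exists phi,
    [/\ x' j.*2 = cos phi * x j.*2 - sin phi * x j.*2.+1,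
        x' j.*2.+1 = sin phi * x j.*2 + cos phi * x j.*2.+1,
        y' j.*2 = cos phi * y j.*2 - sin phi * y j.*2.+1 &
        y' j.*2.+1 = sin phi * y j.*2 + cos phi * y j.*2.+1].
Proof.
move=> re im dt; have nm : blk_norm x y j = blk_norm x' y' j.
  by rewrite !blk_normE re im dt.
move: re im dt nm; rewrite /sqr_re /sqr_im /blk_det /blk_norm => re im dt nm.
(* The boolean selects a column of the block. The complex number attached to it has the entry in row
   [j.*2] as real part and the entry in row [j.*2.+1] as imaginary part. *)
have [||c [s [cs1 rot]]] := @unit_rotation_exists R bool
  (fun b => if b then y j.*2 else x j.*2)
  (fun b => if b then y j.*2.+1 else x j.*2.+1)
  (fun b => if b then y' j.*2 else x' j.*2)
  (fun b => if b then y' j.*2.+1 else x' j.*2.+1).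
- by move=> [] []; lra.
- by move=> [] []; lra.
have [phi [cE sE]] := unit_circle_angle cs1.
by exists phi; rewrite cE sE; have [? ?] := rot false; have [? ?] := rot true.
Qed.

(* The Cholesky factor of the Gram matrix prescribed by [(a, b, d)]. *)
Lemma block_exists (a b d : R) : exists x0 y0 x1 y1 : R,
  [/\ x0 ^+ 2 - y0 ^+ 2 + (x1 ^+ 2 - y1 ^+ 2) = a,
      2 * (x0 * y0 + x1 * y1) = b, x0 * y1 - x1 * y0 = d,
      x1 = 0 & d = 0 -> y1 = 0].
Proof.
have a2 := sqr_ge0 a; have b2 := sqr_ge0 b; have d2 := sqr_ge0 d.
pose L := Num.sqrt (a ^+ 2 + b ^+ 2 + 4 * d ^+ 2).
have L2 : L ^+ 2 = a ^+ 2 + b ^+ 2 + 4 * d ^+ 2.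
  by rewrite sqr_sqrtr//; lra.
have L0 : 0 <= L by exact: sqrtr_ge0.
have La : 0 <= L + a.
  have : `|a| <= L by rewrite -sqrtr_sqr ler_wsqrtr//; lra.
  by rewrite ler_norml => /andP[]; lra.
(* [L] is the intended norm of the block, so [(L + a) / 2] is the squared length of its real column.
   If this is zero, the block is purely imaginary; otherwise the real column is placed on the first
   axis, with length [g]. *)
have [e|ne] := eqVneq (L + a) 0.
  have Ea : a = - L by lra.
  have bd : b ^+ 2 + 4 * d ^+ 2 = 0 by rewrite Ea in L2; lra.
  have /eqP : b ^+ 2 = 0 by lra.
  have /eqP : d ^+ 2 = 0 by lra.
  rewrite !sqrf_eq0 => /eqP -> /eqP ->.
  by exists 0, (Num.sqrt L), 0, 0; split => //; rewrite ?sqr_sqrtr// ?Ea; ring.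
pose g := Num.sqrt ((L + a) / 2).
have g2 : g ^+ 2 = (L + a) / 2 by rewrite sqr_sqrtr// divr_ge0.
have g0 : g != 0 by rewrite -sqrf_eq0 g2 mulf_neq0// invr_eq0.
exists g, (b / 2 / g), 0, (d / g); split => //; last by move=> ->; rewrite mul0r.
- have -> : g ^+ 2 - (b / 2 / g) ^+ 2 + (0 ^+ 2 - (d / g) ^+ 2) =
      g ^+ 2 - (b ^+ 2 + 4 * d ^+ 2) / 4 / g ^+ 2 by field.
  have -> : b ^+ 2 + 4 * d ^+ 2 = L ^+ 2 - a ^+ 2 by rewrite L2; ring.
  by rewrite g2; field.
- by field.
- by field.
Qed.

(** For odd [n] the last pair reaches one index too far, whence the vanishing of [f] from [n] on. *)
Lemma sum_double n (f : nat -> R) : (forall i, (n <= i)%N -> f i = 0) ->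
  \sum_(i < n) f i = \sum_(j < n.+1./2) (f j.*2 + f j.*2.+1).
Proof.
move=> f0.
have -> : \sum_(j < n.+1./2) (f j.*2 + f j.*2.+1) = \sum_(i < n.+1./2.*2) f i.
  elim: n.+1./2 => [|N IH]; first by rewrite !big_ord0.
  by rewrite big_ord_recr /= IH doubleS !big_ord_recr /= addrA.
rewrite -(big_mkord predT f) -(big_mkord predT f).
have nN : (n <= n.+1./2.*2)%N by lia.
rewrite [RHS](big_cat_nat _ nN)//= [X in _ = _ + X]big_nat_cond [X in _ = _ + X]big1 ?addr0//.
by move=> i /andP[/andP[/f0]].
Qed.

End blocks.

(** * Classification of orthonormal frames by their block invariants *)

Section frames.
Variables (R : realType) (n : nat).
Implicit Types (x y : nat -> R) (j : nat).

(** Extending the coordinates by zero turns the lone last coordinate of an odd [n] into a block with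
    second row zero. *)
Definition frame x y :=
  [/\ forall i, (n <= i)%N -> x i = 0 /\ y i = 0,
      \sum_(i < n) x i ^+ 2 = 1, \sum_(i < n) y i ^+ 2 = 1 &
      \sum_(i < n) x i * y i = 0].

Lemma sum_sqr_re x y : (forall i, (n <= i)%N -> x i = 0 /\ y i = 0) ->
  \sum_(j < n.+1./2) sqr_re x y j =
  \sum_(i < n) x i ^+ 2 - \sum_(i < n) y i ^+ 2.
Proof.
move=> xy0; rewrite -sumrB (@sum_double _ _ (fun i => x i ^+ 2 - y i ^+ 2))//.
by move=> i /xy0[-> ->]; ring.
Qed.

Lemma sum_blk_norm x y : (forall i, (n <= i)%N -> x i = 0 /\ y i = 0) ->
  \sum_(j < n.+1./2) blk_norm x y j =
  \sum_(i < n) x i ^+ 2 + \sum_(i < n) y i ^+ 2.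
Proof.
move=> xy0; rewrite -big_split (@sum_double _ _ (fun i => x i ^+ 2 + y i ^+ 2))//.
by move=> i /xy0[-> ->]; ring.
Qed.

Lemma sum_sqr_im x y : (forall i, (n <= i)%N -> x i = 0 /\ y i = 0) ->
  \sum_(j < n.+1./2) sqr_im x y j = 2 * \sum_(i < n) x i * y i.
Proof.
move=> xy0; rewrite (@sum_double _ _ (fun i => x i * y i)) ?mulr_sumr//.
by move=> i /xy0[-> ->]; ring.
Qed.

Lemma blk_det_eq0 x y j : (forall i, (n <= i)%N -> x i = 0 /\ y i = 0) ->
  (n./2 <= j)%N -> blk_det x y j = 0.
Proof.
move=> xy0 nj; have [|x0 y0] := xy0 j.*2.+1; first by lia.
by rewrite /blk_det x0 y0; ring.
Qed.

(** This is the injectivity of the invariants: if the rescaled [d] agree and the rescaled [p] differ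
    by a common phase, then an element of SO_2 removes the phase, and [block_rotation] finishes
    block by block. *)
Lemma frame_rotation x y x' y' (r r' c s : R) :
  (0 < n)%N -> frame x y -> frame x' y' -> 0 < r -> 0 < r' ->
  (forall j, (j < n./2)%N -> blk_det x y j / r = blk_det x' y' j / r') ->
  c ^+ 2 + s ^+ 2 = 1 ->
  (forall j, (j < n.+1./2 - 1)%N ->
     sqr_re x' y' j / r' = c * (sqr_re x y j / r) - s * (sqr_im x y j / r) /\
     sqr_im x' y' j / r' = s * (sqr_re x y j / r) + c * (sqr_im x y j / r)) ->
  exists a b (phi : nat -> R),
    let X i := a * x' i - b * y' i in let Y i := b * x' i + a * y' i in
    [/\ a ^+ 2 + b ^+ 2 = 1,
      forall j, (j < n./2)%N ->
      [/\ X j.*2 = cos (phi j) * x j.*2 - sin (phi j) * x j.*2.+1,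
        X j.*2.+1 = sin (phi j) * x j.*2 + cos (phi j) * x j.*2.+1,
        Y j.*2 = cos (phi j) * y j.*2 - sin (phi j) * y j.*2.+1 &
        Y j.*2.+1 = sin (phi j) * y j.*2 + cos (phi j) * y j.*2.+1] &
      forall i, (n./2.*2 <= i)%N -> X i = x i /\ Y i = y i].
Proof.
move=> n0 [xy0 xx yy xy] [xy0' xx' yy' xy'] r0 r0' dt cs1 re_im.
have {}dt j : blk_det x y j / r = blk_det x' y' j / r'.
  by have [/dt//|nj] := ltnP j n./2; rewrite !blk_det_eq0// !mul0r.
(* The last [p] is minus the sum of the others, so the phase relation extends to it. *)
have {re_im} re_im j : (j < n.+1./2)%N ->
     sqr_re x' y' j / r' = c * (sqr_re x y j / r) - s * (sqr_im x y j / r) /\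
     sqr_im x' y' j / r' = s * (sqr_re x y j / r) + c * (sqr_im x y j / r).
  have [m mE] : exists m, n.+1./2 = m.+1 by exists (n.+1./2).-1; lia.
  rewrite mE ltnS leq_eqVlt => /predU1P[->|jm]; last by apply: re_im; lia.
  have := sum_sqr_re xy0; have := sum_sqr_re xy0'.
  have := sum_sqr_im xy0; have := sum_sqr_im xy0'.
  rewrite mE !big_ord_recr/= xx yy xy xx' yy' xy' mulr0 subrr.
  move=> /eqP + /eqP + /eqP + /eqP.
  rewrite !addr_eq0 => /eqP im' /eqP im /eqP re' /eqP re.
  have {im} -> : sqr_im x y m = - \sum_(j < m) sqr_im x y j by rewrite im opprK.
  have {im'} -> : sqr_im x' y' m = - \sum_(j < m) sqr_im x' y' j by rewrite im' opprK.
  have {re} -> : sqr_re x y m = - \sum_(j < m) sqr_re x y j by rewrite re opprK.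
  have {re'} -> : sqr_re x' y' m = - \sum_(j < m) sqr_re x' y' j by rewrite re' opprK.
  rewrite !mulNr; split.
    rewrite [X in - X = _](_ : _ = c * ((\sum_(j < m) sqr_re x y j) / r)
      - s * ((\sum_(j < m) sqr_im x y j) / r)); first by ring.
    rewrite !mulr_suml !mulr_sumr -sumrB; apply: eq_bigr => i _.
    by have [|-> _] := re_im i; [have := ltn_ord i; lia|].
  rewrite [X in - X = _](_ : _ = s * ((\sum_(j < m) sqr_re x y j) / r)
    + c * ((\sum_(j < m) sqr_im x y j) / r)); first by ring.
  rewrite !mulr_suml !mulr_sumr -big_split; apply: eq_bigr => i _.
  by have [|_ ->] := re_im i; [have := ltn_ord i; lia|].
(* The norm of a block is a function of [(d, p)] that is homogeneous of degree 1 and insensitive to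
   phases. Since the norms of either frame add up to 2, [2 / r = 2 / r']. *)
have rr : r = r'.
  have nm j : (j < n.+1./2)%N -> blk_norm x y j / r = blk_norm x' y' j / r'.
    move=> /re_im [re im].
    have rE (x1 y1 : nat -> R) r1 : 0 < r1 -> blk_norm x1 y1 j / r1 =
        Num.sqrt ((sqr_re x1 y1 j / r1) ^+ 2 + (sqr_im x1 y1 j / r1) ^+ 2 +
          4 * (blk_det x1 y1 j / r1) ^+ 2).
      move=> r10; rewrite -[LHS]ger0_norm ?divr_ge0 ?blk_norm_ge0 ?ltW//.
      rewrite -sqrtr_sqr; congr Num.sqrt; rewrite /blk_norm /sqr_re /sqr_im /blk_det.
      by field; rewrite gt_eqF.
    rewrite !rE// re im dt; congr Num.sqrt; congr (_ + _).
    set A := _ / r; set B := _ / r.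
    by rewrite -[LHS]mul1r -cs1; ring.
  have : \sum_(j < n.+1./2) blk_norm x y j / r =
         \sum_(j < n.+1./2) blk_norm x' y' j / r'.
    by apply: eq_bigr => j _; exact: nm.
  rewrite -!mulr_suml !sum_blk_norm// xx yy xx' yy' => /mulfI h.
  by apply: invr_inj; apply: h; rewrite -mulr2n pnatr_eq0.
have rn0 : r != 0 by rewrite gt_eqF.
have [psi [psic psis]] := unit_circle_angle cs1.
(* The [p] are sums of squares of the coordinates, so turning [z'] by minus half the angle
   multiplies them by the inverse of the phase [c + 'i s]. *)
pose a := cos (- (psi / 2)); pose b := sin (- (psi / 2)).
have ab1 : a ^+ 2 + b ^+ 2 = 1 by rewrite cos2Dsin2.
have cE : c = a ^+ 2 - b ^+ 2.
  rewrite -psic [in LHS](_ : psi = psi / 2 + psi / 2); last by field.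
  by rewrite cosD /a /b cosN sinN; ring.
have sE : s = - (2 * a * b).
  rewrite -psis [in LHS](_ : psi = psi / 2 + psi / 2); last by field.
  by rewrite sinD /a /b cosN sinN; ring.
pose X i := a * x' i - b * y' i; pose Y i := b * x' i + a * y' i.
have XY0 i : (n <= i)%N -> X i = 0 /\ Y i = 0.
  by move=> /xy0'[x0 y0]; rewrite /X /Y x0 y0; split; ring.
have rot j : (j < n.+1./2)%N -> exists phi,
    [/\ X j.*2 = cos phi * x j.*2 - sin phi * x j.*2.+1,
        X j.*2.+1 = sin phi * x j.*2 + cos phi * x j.*2.+1,
        Y j.*2 = cos phi * y j.*2 - sin phi * y j.*2.+1 &
        Y j.*2.+1 = sin phi * y j.*2 + cos phi * y j.*2.+1].
  move=> /re_im[]; rewrite -rr => re im.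
  have {}re : sqr_re x' y' j = c * sqr_re x y j - s * sqr_im x y j.
    by apply: (divIf rn0); rewrite re; ring.
  have {}im : sqr_im x' y' j = s * sqr_re x y j + c * sqr_im x y j.
    by apply: (divIf rn0); rewrite im; ring.
  have dtj := dt j; rewrite -rr in dtj; move/(divIf rn0) in dtj.
  apply: block_rotation.
  (* The phase relation is inverted as [p = (c - 'i s) p'], and the right-hand side is the invariant
     of the turned block. *)
  - transitivity (c * sqr_re x' y' j + s * sqr_im x' y' j).
      by rewrite re im -[LHS]mul1r -cs1; ring.
    by rewrite cE sE /X /Y /sqr_re /sqr_im; ring.
  - transitivity (c * sqr_im x' y' j - s * sqr_re x' y' j).
      by rewrite re im -[LHS]mul1r -cs1; ring.
    by rewrite cE sE /X /Y /sqr_re /sqr_im; ring.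
  - transitivity (blk_det x' y' j); first by [].
    by rewrite -[LHS]mul1r -ab1 /X /Y /blk_det; ring.
have /choice[phi phiP] : forall j, exists p, (j < n.+1./2)%N ->
    [/\ X j.*2 = cos p * x j.*2 - sin p * x j.*2.+1,
        X j.*2.+1 = sin p * x j.*2 + cos p * x j.*2.+1,
        Y j.*2 = cos p * y j.*2 - sin p * y j.*2.+1 &
        Y j.*2.+1 = sin p * y j.*2 + cos p * y j.*2.+1].
  by move=> j; have [/rot[p ?]|jn] := ltnP j n.+1./2; [exists p|exists 0].
have [k kE] : exists k, k = n./2 by exists n./2.
(* For odd [n] the last coordinate is only determined up to sign. *)
have [e [e1 eP]] : exists e : R, (e = 1 \/ e = -1) /\
    forall i, (n./2.*2 <= i)%N -> e * X i = x i /\ e * Y i = y i.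
  have [nodd|neven] := boolP (odd n); last first.
    exists 1; split; first by left.
    move=> i ni; have [|-> ->] := XY0 i; first by lia.
    by have [|-> ->] := xy0 i; [lia|rewrite mulr0].
  have [x0 y0] : x k.*2.+1 = 0 /\ y k.*2.+1 = 0 by apply: xy0; lia.
  have [X0 Y0] : X k.*2.+1 = 0 /\ Y k.*2.+1 = 0 by apply: XY0; lia.
  have [|Xx XS Yy YS] := phiP k; first by lia.
  rewrite x0 X0 y0 Y0 !mulr0 !addr0 !subr0 in Xx XS Yy YS.
  have iE e : e * X k.*2 = x k.*2 /\ e * Y k.*2 = y k.*2 ->
      forall i, (n./2.*2 <= i)%N -> e * X i = x i /\ e * Y i = y i.
    move=> ek i; rewrite -kE leq_eqVlt => /predU1P[<-//|ki].
    have [|-> ->] := XY0 i; first by lia.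
    by have [|-> ->] := xy0 i; [lia|rewrite mulr0].
  (* As the second row of the last block is zero, [XS] and [YS] say that [sin (phi k)] annihilates
     [x k.*2] and [y k.*2]. Either the rotation is by plus or minus the identity, or the last
     coordinate of both vectors is zero. *)
  have [s0|s0] := eqVneq (sin (phi k)) 0.
    have /eqP := cos2Dsin2 (phi k).
    rewrite s0 expr0n addr0 sqrf_eq1 => /orP[]/eqP c1.
      by exists 1; split; [left|apply: iE; rewrite Xx Yy c1 !mul1r].
    by exists (-1); split; [right|apply: iE; rewrite Xx Yy c1; split; ring].
  exists 1; split; [by left|apply: iE].
  move/esym/eqP : XS; rewrite mulf_eq0 (negPf s0)/= => /eqP xk0.
  move/esym/eqP : YS; rewrite mulf_eq0 (negPf s0)/= => /eqP yk0.
  by rewrite Xx Yy xk0 yk0 !mulr0.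
(* A sign [-1] in SO_2 is compensated by adding [pi] to every angle. *)
pose f j := if e == 1 then phi j else phi j + pi.
exists (e * a), (e * b), f => /=.
have fP j : cos (f j) = e * cos (phi j) /\ sin (f j) = e * sin (phi j).
  rewrite /f; have [->|ne1] := eqVneq e 1; first by rewrite !mul1r.
  case: e1 => [e1|->]; first by rewrite e1 eqxx in ne1.
  by rewrite cosDpi sinDpi !mulN1r.
split.
- by rewrite !exprMn -mulrDr ab1 mulr1; case: e1 => ->; ring.
- move=> j jn; have [|h1 h2 h3 h4] := phiP j; first by lia.
  have [-> ->] := fP j; rewrite /X /Y in h1 h2 h3 h4.
  split; [move: h1|move: h2|move: h3|move: h4] => h; rewrite -!mulrA -?mulrBr -?mulrDr h //.
- by move=> i /eP[<- <-]; rewrite /X /Y; split; ring.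
Qed.

(** The blocks come from [block_exists] and are scaled together. That [p] and [q] sum to zero makes
    the two vectors equally long and orthogonal. *)
Lemma frame_exists (d p q : nat -> R) :
  (forall j, (n./2 <= j)%N -> d j = 0) ->
  \sum_(j < n.+1./2) p j = 0 -> \sum_(j < n.+1./2) q j = 0 ->
  0 < \sum_(j < n.+1./2) Num.sqrt (p j ^+ 2 + q j ^+ 2 + 4 * d j ^+ 2) ->
  exists x y l, [/\ 0 < l, frame x y & forall j, (j < n.+1./2)%N ->
    [/\ sqr_re x y j = l * p j, sqr_im x y j = l * q j &
        blk_det x y j = l * d j]].
Proof.
move=> d0 p0 q0; set L := \sum_(j < _) Num.sqrt _ => L0.
have /choice[x0 /choice[y0 /choice[x1 /choice[y1 P]]]] :=
  fun j => block_exists (p j) (q j) (d j).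
(* A frame has total norm 2 while the unscaled blocks have [L]. The invariants are quadratic, so the
   coordinates are scaled by the square root of [l]. *)
pose l := 2 / L; have l0 : 0 < l by rewrite divr_gt0.
pose u := Num.sqrt l; have u2 : u ^+ 2 = l by rewrite sqr_sqrtr// ltW.
pose x i := if (i./2 < n.+1./2)%N then u * (if odd i then x1 i./2 else x0 i./2) else 0.
pose y i := if (i./2 < n.+1./2)%N then u * (if odd i then y1 i./2 else y0 i./2) else 0.
have blkP j : (j < n.+1./2)%N ->
    [/\ sqr_re x y j = l * p j, sqr_im x y j = l * q j & blk_det x y j = l * d j].
  move=> jn; have [<- <- <- _ _] := P j.
  rewrite /sqr_re /sqr_im /blk_det /x /y /= uphalf_double doubleK jn odd_double/= -u2.
  by split; ring.
(* The only index from [n] on that lies in a block is [n] itself, for odd [n]. It is the second row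
   of the last block, where [d] is zero, and [block_exists] puts zeros there. *)
have xy0 i : (n <= i)%N -> x i = 0 /\ y i = 0.
  move=> ni; rewrite /x /y; case: ifPn => // iN.
  have -> : odd i by lia.
  have [_ _ _ -> ->] := P i./2; first by rewrite mulr0.
  by apply: d0; lia.
have nm : \sum_(j < n.+1./2) blk_norm x y j = 2.
  transitivity (l * L); last by rewrite /l divfK// gt_eqF.
  rewrite /L mulr_sumr; apply: eq_bigr => j _; rewrite blk_normE.
  have [-> -> ->] := blkP j (ltn_ord j).
  have -> : (l * p j) ^+ 2 + (l * q j) ^+ 2 + 4 * (l * d j) ^+ 2 =
    l ^+ 2 * (p j ^+ 2 + q j ^+ 2 + 4 * d j ^+ 2) by ring.
  by rewrite sqrtrM ?sqr_ge0// sqrtr_sqr gtr0_norm.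
have re : \sum_(j < n.+1./2) sqr_re x y j = 0.
  transitivity (l * \sum_(j < n.+1./2) p j); last by rewrite p0 mulr0.
  by rewrite mulr_sumr; apply: eq_bigr => j _; have [] := blkP j (ltn_ord j).
have im : \sum_(j < n.+1./2) sqr_im x y j = 0.
  transitivity (l * \sum_(j < n.+1./2) q j); last by rewrite q0 mulr0.
  by rewrite mulr_sumr; apply: eq_bigr => j _; have [] := blkP j (ltn_ord j).
exists x, y, l; split=> //; split=> //.
- by rewrite sum_sqr_re// in re; rewrite sum_blk_norm// in nm; lra.
- by rewrite sum_sqr_re// in re; rewrite sum_blk_norm// in nm; lra.
- by rewrite sum_sqr_im// in im; lra.
Qed.

End frames.

(** * Real vectors and complex vectors modulo a phase *)

Section profile.
Variables (R : realType) (k m : nat).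

Definition profile_index : eqType := ('I_k + bool * 'I_m * 'I_m)%type.

(* Coordinates of [(d, p p^* )] for the column vector [p = a + 'i b]. *)
Definition profile (d : 'I_k -> R) (a b : 'I_m -> R) (u : profile_index) : R :=
  match u with
  | inl j => d j
  | inr (true, i, j) => a i * a j + b i * b j
  | inr (false, i, j) => b i * a j - a i * b j
  end.

Lemma profile_rotation d a b (c s : R) : c ^+ 2 + s ^+ 2 = 1 ->
  profile d (fun j => c * a j - s * b j) (fun j => s * a j + c * b j) =
  profile d a b.
Proof.
move=> cs1; apply/funext => -[//|[[[] i] j]] /=.
  by rewrite -[RHS]mul1r -cs1; ring.
by rewrite -[RHS]mul1r -cs1; ring.
Qed.

Lemma profile_inj d a b d' a' b' : profile d a b = profile d' a' b' ->
  d = d' /\ exists c s : R, c ^+ 2 + s ^+ 2 = 1 /\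
    forall j, a' j = c * a j - s * b j /\ b' j = s * a j + c * b j.
Proof.
move=> e; split; first by apply/funext => j; exact: (congr1 (@^~ (inl j)) e).
apply: unit_rotation_exists => i j.
- exact: (congr1 (@^~ (inr (true, i, j))) e).
- exact: (congr1 (@^~ (inr (false, i, j))) e).
Qed.

End profile.

(** * Continuity of real-valued functions *)

Section real_continuity.
Variables (R : realType) (T : topologicalType).
Implicit Types f g : T -> R.

Lemma continuous_add f g : continuous f -> continuous g ->
  continuous (fun x => f x + g x).
Proof. by move=> cf cg x; apply: cvgD; [exact: cf|exact: cg]. Qed.

Lemma continuous_sub f g : continuous f -> continuous g ->
  continuous (fun x => f x - g x).
Proof. by move=> cf cg x; apply: cvgB; [exact: cf|exact: cg]. Qed.

Lemma continuous_mul f g : continuous f -> continuous g ->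
  continuous (fun x => f x * g x).
Proof. by move=> cf cg x; apply: cvgM; [exact: cf|exact: cg]. Qed.

Lemma continuous_exprn f n : continuous f -> continuous (fun x => f x ^+ n).
Proof.
move=> cf; elim: n => [|n IH]; first exact: cst_continuous.
by rewrite (_ : (fun x => _) = (fun x => f x * f x ^+ n));
  [exact: continuous_mul|apply/funext => x; exact: exprS].
Qed.

Lemma continuous_sum (I : Type) (r : seq I) (F : I -> T -> R) :
  (forall i, continuous (F i)) -> continuous (fun x => \sum_(i <- r) F i x).
Proof. by move=> cF; apply: continuous_big => //; exact: add_continuous. Qed.

Lemma continuous_div_sqrt f g : (forall x, 0 < g x) -> continuous f ->
  continuous g -> continuous (fun x => f x / Num.sqrt (g x)).
Proof.
move=> g0 cf cg x; apply: cvgM; first exact: cf.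
apply: cvgV; first by rewrite gt_eqF// sqrtr_gt0.
by apply: continuous_comp; [exact: cg|exact: sqrt_continuous].
Qed.

Lemma continuous_profile k m (d : T -> 'I_k -> R) (a b : T -> 'I_m -> R) u :
  (forall j, continuous (d ^~ j)) -> (forall j, continuous (a ^~ j)) ->
  (forall j, continuous (b ^~ j)) ->
  continuous (fun x => profile (d x) (a x) (b x) u).
Proof.
move=> cd ca cb; case: u => [j|[[[] i] j]] /=; first exact: cd.
- by apply: continuous_add; apply: continuous_mul.
- by apply: continuous_sub; apply: continuous_mul.
Qed.

End real_continuity.

(** * Row vectors and the unit sphere *)

Section row_vectors.
Variables (R : realType).

Lemma continuous_row1 m i : continuous (fun v : 'rV[R]_m * 'rV[R]_m => v.1 ord0 i).
Proof.
move=> v; apply: (@continuous_comp _ _ _ fst (fun w : 'rV[R]_m => w ord0 i)).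
  exact: cvg_fst.
exact: coord_continuous.
Qed.

Lemma continuous_row2 m i : continuous (fun v : 'rV[R]_m * 'rV[R]_m => v.2 ord0 i).
Proof.
move=> v; apply: (@continuous_comp _ _ _ snd (fun w : 'rV[R]_m => w ord0 i)).
  exact: cvg_snd.
exact: coord_continuous.
Qed.

Lemma compact_box m : compact [set v : 'rV[R]_m | forall i, `[-1, 1]%classic (v ord0 i)].
Proof. by apply: (@rV_compact _ _ (fun=> _)) => _; exact: segment_compact. Qed.

Lemma compact_level (T : topologicalType) (B : set T) (f : T -> R) (c : R) :
  compact B -> continuous f -> [set x | f x = c] `<=` B -> compact [set x | f x = c].
Proof.
move=> cB cf fB; apply: subclosed_compact cB fB.
apply: (@preimage_closed _ _ f [set c]); last exact: closed_eq.
by move=> x _; exact: cf.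
Qed.

Lemma sqr_le1_itv (u : R) : u ^+ 2 <= 1 -> `[-1, 1]%classic u.
Proof.
move=> u1; rewrite /= in_itv /= -ler_norml -(@ler_pXn2r _ 2)// ?nnegrE//.
by rewrite expr1n real_normK ?num_real.
Qed.

Lemma continuous_unit_sphere k j :
  continuous (fun s : unit_sphere R k => (set_val s : 'rV[R]_k) ord0 j).
Proof.
move=> s; apply: (@continuous_comp _ _ _ (fun s : unit_sphere R k => set_val s)
  (fun w : 'rV[R]_k => w ord0 j)); first exact: initial_continuous.
exact: coord_continuous.
Qed.

Lemma compact_unit_sphere k : compact [set: unit_sphere R k].
Proof.
rewrite (_ : setT = set_val @^-1` [set x : 'rV[R]_k | \sum_(i < k) x ord0 i ^+ 2 = 1]).
  apply: compact_set_type => //; apply: compact_level (@compact_box k) _ _.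
    by apply: continuous_sum => i; apply: continuous_exprn; exact: coord_continuous.
  move=> x /= x1 i; apply: sqr_le1_itv; rewrite -x1 (bigD1 i)//= lerDl.
  by rewrite sumr_ge0// => j _; exact: sqr_ge0.
by rewrite eqEsubset; split => // s _; exact: set_valP.
Qed.

End row_vectors.

(** * Frames, SO_2 and the torus in coordinates *)

Section stiefel.
Variables (R : realType) (n : nat).
Implicit Types (V : 'M[R]_(n, 2)) (x y : nat -> R).

Definition entry V (c : 'I_2) (i : nat) : R :=
  if insub i is Some i' then V i' c else 0.

Lemma entryE V c (i : 'I_n) : entry V c i = V i c.
Proof. by rewrite /entry valK. Qed.

Lemma entry_out V c i : (n <= i)%N -> entry V c i = 0.
Proof. by move=> ni; rewrite /entry insubF// ltnNge ni. Qed.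

Lemma entry_inj V W : (forall c i, entry V c i = entry W c i) -> V = W.
Proof. by move=> VW; apply/matrixP => i c; rewrite -!entryE. Qed.

Lemma big_ord2 (f : 'I_2 -> R) : \sum_c f c = f ord0 + f ord_max.
Proof.
rewrite !big_ord_recl big_ord0 addr0; congr (_ + f _); exact: val_inj.
Qed.

Lemma forall_ord2 (P : 'I_2 -> Prop) : (forall c, P c) <-> P ord0 /\ P ord_max.
Proof.
split=> [h //|[P0 P1] c]; have [c0|c0] := eqVneq c ord0; first by rewrite c0.
by have -> : c = ord_max by apply/val_inj; case: c c0 => [[|[|]]].
Qed.

Lemma entry_mulmx V (A : 'M[R]_2) c i :
  entry (V *m A) c i = entry V ord0 i * A ord0 c + entry V ord_max i * A ord_max c.
Proof.
rewrite /entry; case: insubP => [i' _ _|_]; last by rewrite !mul0r addr0.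
by rewrite mxE big_ord2.
Qed.

Lemma stiefelP V : @stiefel R n V <-> frame n (entry V ord0) (entry V ord_max).
Proof.
have E a b : (V^T *m V) a b = \sum_(i < n) entry V a i * entry V b i.
  by rewrite mxE; apply: eq_bigr => i _; rewrite mxE !entryE.
split => [/matrixP VV|[_ xx yy xy]].
- split; first by move=> i ni; rewrite !entry_out.
  + by have := VV ord0 ord0; rewrite E mxE.
  + by have := VV ord_max ord_max; rewrite E mxE.
  + by have := VV ord0 ord_max; rewrite E mxE.
- apply/matrixP => a b; rewrite E mxE; move: a b.
  apply/forall_ord2; split; apply/forall_ord2; split; rewrite ?eqxx //=.
  by apply: etrans xy; apply: eq_bigr => i _; rewrite mulrC.
Qed.

Lemma stiefel_of_frame x y : frame n x y -> exists V,
  @stiefel R n V /\ forall i, entry V ord0 i = x i /\ entry V ord_max i = y i.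
Proof.
move=> fxy; have [xy0 _ _ _] := fxy.
pose V : 'M[R]_(n, 2) := \matrix_(i, c) if c == ord0 then x i else y i.
have VE i : entry V ord0 i = x i /\ entry V ord_max i = y i.
  have [i_n|ni] := ltnP i n; last by rewrite !entry_out//; have [-> ->] := xy0 i ni.
  by have := entryE V ^~ (Ordinal i_n) => /= E; rewrite !E !mxE.
exists V; split => //; apply/stiefelP.
have -> : entry V ord0 = x by apply/funext => i; have [] := VE i.
by have -> : entry V ord_max = y by apply/funext => i; have [] := VE i.
Qed.

Lemma SO2P (A : 'M[R]_2) : @SO2 R A <->
  [/\ A ord0 ord0 ^+ 2 + A ord_max ord0 ^+ 2 = 1,
      A ord_max ord_max = A ord0 ord0 & A ord0 ord_max = - A ord_max ord0].
Proof.
have E a b : (A^T *m A) a b = A ord0 a * A ord0 b + A ord_max a * A ord_max b.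
  by rewrite mxE big_ord2 !mxE.
have D : \det A = A ord0 ord0 * A ord_max ord_max - A ord0 ord_max * A ord_max ord0.
  rewrite (expand_det_row _ ord0) big_ord2 /cofactor !det_mx11 !mxE /=.
  have -> : lift ord0 0 = ord_max :> 'I_2 by exact: val_inj.
  have -> : lift ord_max 0 = ord0 :> 'I_2 by exact: val_inj.
  by rewrite !add0n expr0 expr1; ring.
split => [[/matrixP AA dA]|[ab1 a11 a01]].
- have := AA ord0 ord0; have := AA ord_max ord_max; rewrite !E !mxE /=.
  rewrite D in dA.
  move: (A ord0 ord0) (A ord0 ord_max) (A ord_max ord0) (A ord_max ord_max) dA.
  move=> a b c d; rewrite mulr1n => h1 h2 h3.
  (* This is the sum of the four squared entries minus twice the determinant, that is [2 - 2]. *)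
  have : (d - a) ^+ 2 + (b + c) ^+ 2 = 0.
    transitivity ((b * b + d * d) + (a * a + c * c) - 2 * (a * d - b * c)); first by ring.
    by rewrite h1 h2 h3; ring.
  move=> /eqP; rewrite paddr_eq0 ?sqr_ge0// !sqrf_eq0 subr_eq0 addr_eq0.
  by move=> /andP[/eqP -> /eqP ->]; split=> //; rewrite -h3; ring.
- split; last by rewrite D a11 a01 -ab1; ring.
  apply/matrixP => a b; rewrite E mxE; move: a b.
  apply/forall_ord2; split; apply/forall_ord2; split; rewrite ?eqxx /= ?a11 ?a01 -?ab1; ring.
Qed.

(** After the columns are grouped in pairs, only the pair of index [i./2] meets row [i]. *)
Lemma entry_torus (phi : nat -> R) V c i :
  entry (torus_mx n phi *m V) c i =
  if (i < n./2.*2)%N then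
    if odd i then sin (phi i./2) * entry V c i./2.*2 + cos (phi i./2) * entry V c i./2.*2.+1
    else cos (phi i./2) * entry V c i./2.*2 - sin (phi i./2) * entry V c i./2.*2.+1
  else entry V c i.
Proof.
have [i_n|ni] := ltnP i n; last first.
  by rewrite ifF ?entry_out//; apply/negbTE; rewrite -leqNgt; lia.
have := entryE (torus_mx n phi *m V) c (Ordinal i_n) => /= ->.
pose g j := (if (i < n./2.*2)%N && (i./2 == j./2)%N
  then rot_entry (phi i./2) (odd i) (odd j) else (i == j)%:R) * entry V c j.
have -> : (torus_mx n phi *m V) (Ordinal i_n) c = \sum_(j < n) g j.
  by rewrite mxE; apply: eq_bigr => j _; rewrite mxE /g entryE/= mul2n.
rewrite sum_double; last by move=> j nj; rewrite /g entry_out// mulr0.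
have iN : (i./2 < n.+1./2)%N by lia.
rewrite (bigD1 (Ordinal iN))//= big1 ?addr0; last first.
  move=> j /eqP ji; have {}ji : i./2 <> j by move=> e; apply: ji; exact: val_inj.
  rewrite /g /= uphalf_double doubleK; have /eqP/negPf -> := ji; rewrite andbF.
  have /eqP/negPf -> : i <> j.*2 by lia.
  have /eqP/negPf -> : i <> j.*2.+1 by lia.
  by rewrite !mul0r addr0.
rewrite /g /= uphalf_double doubleK eqxx andbT odd_double/=.
case: ifPn => [_|ni].
  by case: (odd i) => /=; rewrite ?mulNr.
have ii : i = i./2.*2 by lia.
have -> : (i == i./2.*2) = true by apply/eqP.
rewrite mul1r.
have /eqP/negPf -> : i <> i./2.*2.+1 by lia.
by rewrite mul0r addr0 -ii.
Qed.

End stiefel.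

(** * The normalized invariants on the Stiefel manifold *)

Section stiefel_invariants.
Variables (R : realType) (n : nat).
Hypothesis n0 : (0 < n)%N.
Implicit Types (x y : nat -> R) (V W : Stiefel R n).

(** The squared length of [(d, p)] in R^k x C^m. The last [p] is left out because it is determined
    by the others. *)
Definition mass x y : R :=
  \sum_(j < n./2) blk_det x y j ^+ 2 +
  \sum_(j < n.+1./2 - 1) (sqr_re x y j ^+ 2 + sqr_im x y j ^+ 2).

Definition frame_profile x y : profile_index n./2 (n.+1./2 - 1) -> R :=
  profile (fun j => blk_det x y j / Num.sqrt (mass x y))
    (fun j => sqr_re x y j / Num.sqrt (mass x y))
    (fun j => sqr_im x y j / Num.sqrt (mass x y)).

Lemma mass_ge0 x y : 0 <= mass x y.
Proof.
by rewrite addr_ge0// sumr_ge0// => j _; rewrite ?addr_ge0 ?sqr_ge0.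
Qed.

(** If every [d] and every [p] but the last vanish, then the last [p] vanishes as well, since the
    [p] sum to zero. All block norms are then zero, although they add up to 2. *)
Lemma mass_gt0 x y : frame n x y -> 0 < mass x y.
Proof.
move=> [xy0 xx yy xy]; rewrite lt_neqAle mass_ge0 andbT eq_sym.
apply/eqP => /eqP.
rewrite paddr_eq0 ?sumr_ge0// => [|j _|j _]; rewrite ?addr_ge0 ?sqr_ge0//.
rewrite !psumr_eq0 => [|j _|j _]; rewrite ?addr_ge0 ?sqr_ge0//.
move=> /andP[/allP d0 /allP p0].
have {}d0 j : blk_det x y j = 0.
  have [jk|kj] := ltnP j n./2; last exact: blk_det_eq0 kj.
  by have := d0 (Ordinal jk) (mem_index_enum _); rewrite /= sqrf_eq0 => /eqP.
have {}p0 j : (j < n.+1./2 - 1)%N -> sqr_re x y j = 0 /\ sqr_im x y j = 0.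
  move=> jm; have := p0 (Ordinal jm) (mem_index_enum _).
  by rewrite /= paddr_eq0 ?sqr_ge0// !sqrf_eq0 => /andP[/eqP -> /eqP ->].
have [N NE] : exists N, n.+1./2 = N.+1 by exists (n.+1./2).-1; lia.
have pN : sqr_re x y N = 0 /\ sqr_im x y N = 0.
  have := sum_sqr_re xy0; have := sum_sqr_im xy0.
  rewrite NE xx yy xy subrr mulr0 !big_ord_recr/=.
  rewrite !big1 ?add0r// => j _; have [|//] := p0 j; rewrite NE; have := ltn_ord j; lia.
have := sum_blk_norm xy0; rewrite xx yy big1 => [/eqP|j _].
  by rewrite eq_sym -mulr2n pnatr_eq0.
rewrite blk_normE d0.
have [-> ->] : sqr_re x y j = 0 /\ sqr_im x y j = 0.
  have [jm|mj] := ltnP j (n.+1./2 - 1); first exact: p0.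
  by have -> : nat_of_ord j = N by have := ltn_ord j; lia.
by rewrite expr0n mulr0 !addr0 sqrtr0.
Qed.

Lemma frame_profile_rotation x y x' y' c s : c ^+ 2 + s ^+ 2 = 1 ->
  (forall j, blk_det x' y' j = blk_det x y j) ->
  (forall j, sqr_re x' y' j = c * sqr_re x y j - s * sqr_im x y j) ->
  (forall j, sqr_im x' y' j = s * sqr_re x y j + c * sqr_im x y j) ->
  frame_profile x' y' = frame_profile x y.
Proof.
move=> cs1 dt re im.
have M : mass x' y' = mass x y.
  rewrite /mass; congr (_ + _); apply: eq_bigr => j _; first by rewrite dt.
  by rewrite re im -[RHS]mul1r -cs1; ring.
rewrite /frame_profile M -[RHS](profile_rotation _ _ _ cs1).
congr profile; apply/funext => j; rewrite ?dt// ?re ?im; ring.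
Qed.

Definition stiefel_profile V :=
  frame_profile (entry (set_val V) ord0) (entry (set_val V) ord_max).

Lemma stiefel_frame V :
  frame n (entry (set_val V) ord0) (entry (set_val V) ord_max).
Proof. by apply/stiefelP; exact: set_valP. Qed.

Lemma stiefel_profile_so2 V W : so2_orbit V W ->
  stiefel_profile V = stiefel_profile W.
Proof.
move=> [A /SO2P[ab1 a11 a01] WE]; apply/esym; rewrite /stiefel_profile WE.
set a := A ord0 ord0 in ab1 a11; set b := A ord_max ord0 in ab1 a01.
(* Right multiplication by [A] multiplies [x + 'i y] by [a - 'i b]; the [p] are multiplied by its
   square. *)
apply: (@frame_profile_rotation _ _ _ _ (a ^+ 2 - b ^+ 2) (- (2 * a * b))).
- transitivity ((a ^+ 2 + b ^+ 2) ^+ 2); first by ring.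
  by rewrite ab1 expr1n.
- move=> j; rewrite /blk_det !entry_mulmx a11 a01 -/a -/b.
  by rewrite -[RHS]mul1r -ab1; ring.
- by move=> j; rewrite /sqr_re /sqr_im !entry_mulmx a11 a01 -/a -/b; ring.
- by move=> j; rewrite /sqr_re /sqr_im !entry_mulmx a11 a01 -/a -/b; ring.
Qed.

Lemma stiefel_profile_torus V W phi :
  set_val W = torus_mx n phi *m set_val V ->
  stiefel_profile V = stiefel_profile W.
Proof.
move=> WE; apply/esym; rewrite /stiefel_profile WE.
set x := entry (set_val V) ord0; set y := entry (set_val V) ord_max.
have T c j : (j < n./2)%N ->
    entry (torus_mx n phi *m set_val V) c j.*2 =
      cos (phi j) * entry (set_val V) c j.*2 - sin (phi j) * entry (set_val V) c j.*2.+1 /\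
    entry (torus_mx n phi *m set_val V) c j.*2.+1 =
      sin (phi j) * entry (set_val V) c j.*2 + cos (phi j) * entry (set_val V) c j.*2.+1.
  move=> jn; rewrite !entry_torus /= uphalf_double doubleK odd_double /=.
  by rewrite ltn_double jn ifT//; lia.
have T' c j : (n./2 <= j)%N ->
    entry (torus_mx n phi *m set_val V) c j.*2 = entry (set_val V) c j.*2 /\
    entry (torus_mx n phi *m set_val V) c j.*2.+1 = entry (set_val V) c j.*2.+1.
  by move=> nj; rewrite !entry_torus !ifF//; lia.
apply: (@frame_profile_rotation _ _ _ _ 1 0); first by ring.
- move=> j; rewrite /blk_det; have [jn|nj] := ltnP j n./2.
    have [-> ->] := T ord0 j jn; have [-> ->] := T ord_max j jn.
    by rewrite -[RHS]mul1r -(cos2Dsin2 (phi j)) -/x -/y; ring.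
  by have [-> ->] := T' ord0 j nj; have [-> ->] := T' ord_max j nj.
- move=> j; rewrite mul1r mul0r subr0 /sqr_re; have [jn|nj] := ltnP j n./2.
    have [-> ->] := T ord0 j jn; have [-> ->] := T ord_max j jn.
    by rewrite -[RHS]mul1r -(cos2Dsin2 (phi j)) -/x -/y; ring.
  by have [-> ->] := T' ord0 j nj; have [-> ->] := T' ord_max j nj.
- move=> j; rewrite mul1r mul0r add0r /sqr_im; have [jn|nj] := ltnP j n./2.
    have [-> ->] := T ord0 j jn; have [-> ->] := T ord_max j jn.
    by rewrite -[RHS]mul1r -(cos2Dsin2 (phi j)) -/x -/y; ring.
  by have [-> ->] := T' ord0 j nj; have [-> ->] := T' ord_max j nj.
Qed.

(** Equal profiles yield a phase between the normalized [p], which is the input of [frame_rotation]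
    with the square roots of the two masses as [r] and [r']. *)
Lemma stiefel_profile_inj V W : stiefel_profile V = stiefel_profile W ->
  exists A phi, @SO2 R A /\ set_val W *m A = torus_mx n phi *m set_val V.
Proof.
move=> /profile_inj[dt [c [s [cs1 re_im]]]].
have mass0 (U : Stiefel R n) : 0 < Num.sqrt (mass (entry (set_val U) ord0) (entry (set_val U) ord_max)).
  by rewrite sqrtr_gt0; apply: mass_gt0; exact: stiefel_frame.
have dt' j (jk : (j < n./2)%N) := congr1 (@^~ (Ordinal jk)) dt.
have re_im' j (jm : (j < n.+1./2 - 1)%N) := re_im (Ordinal jm).
have [a [b [phi [ab1 rot fix0]]]] := frame_rotation n0 (stiefel_frame V)
  (stiefel_frame W) (mass0 V) (mass0 W) dt' cs1 re_im'.
(* Right multiplication by this matrix is multiplication of [x + 'i y] by [a + 'i b]. *)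
pose A : 'M[R]_2 := \matrix_(i, j)
  if i == j then a else if i == ord0 then b else - b.
exists A, phi; split.
  by apply/SO2P; rewrite !mxE /= sqrrN opprK.
apply: entry_inj => cc i; rewrite entry_mulmx entry_torus.
move: cc; apply/forall_ord2; rewrite !mxE /=.
case: ifPn => [ik|]; last first.
  by rewrite -leqNgt => /fix0[<- <-]; split; ring.
have [|h1 h2 h3 h4] := rot i./2; first by lia.
have [io|io] := boolP (odd i).
  have ii : i = i./2.*2.+1 by lia.
  by rewrite -h2 -h4 -ii; split; ring.
have ii : i = i./2.*2 by lia.
by rewrite -h1 -h3 -ii; split; ring.
Qed.

End stiefel_invariants.

Definition normalized (R : realType) k m (d : 'I_k -> R) (a b : 'I_m -> R) :=
  \sum_j d j ^+ 2 + \sum_j (a j ^+ 2 + b j ^+ 2) = 1.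

(** * The orbit space of the Grassmannian and its embedding *)

Section grassmannian.
Variables (R : realType) (n : nat).
Hypothesis n0 : (0 < n)%N.

Lemma frame_profile_normalized (x y : nat -> R) : frame n x y ->
  exists d a b, @normalized R n./2 (n.+1./2 - 1) d a b /\
    frame_profile x y = profile d a b.
Proof.
move=> /(mass_gt0 n0) M0; do 3 eexists; split; last by reflexivity.
rewrite /normalized /=.
have sq (u : R) : (u / Num.sqrt (mass n x y)) ^+ 2 = u ^+ 2 / mass n x y.
  by rewrite exprMn exprVn sqr_sqrtr// ltW.
under eq_bigr do rewrite sq.
under [X in _ + X]eq_bigr do rewrite !sq -mulrDl.
by rewrite -!mulr_suml -mulrDl -/(mass n x y) divff// gt_eqF.
Qed.

(** The missing last [p] is defined by the relation that all of them sum to zero, and [frame_exists]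
    realizes the data up to a positive scale, which the normalization removes. *)
Lemma stiefel_profile_surj d a b : @normalized R n./2 (n.+1./2 - 1) d a b ->
  exists V : Stiefel R n, stiefel_profile V = profile d a b.
Proof.
move=> dab1.
have [N NE] : exists N, n.+1./2 = N.+1 by exists (n.+1./2).-1; lia.
pose D (j : nat) : R := if insub j is Some j' then d j' else 0.
(* The default value is what the last block receives, so that the extended family sums to zero. *)
pose ext (f : 'I_(n.+1./2 - 1) -> R) (j : nat) : R :=
  if insub j is Some j' then f j' else - \sum_j f j.
have ext0 f : \sum_(j < n.+1./2) ext f j = 0.
  rewrite NE big_ord_recr /= {2}/ext insubF ?addrN; last by rewrite NE; lia.
  apply/eqP; rewrite subr_eq0; apply/eqP.
  have NN : N = (n.+1./2 - 1)%N by rewrite NE; lia.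
  by rewrite -(big_mkord predT (ext f)) NN big_mkord; apply: eq_bigr => j _; rewrite /ext valK.
have DE (j : 'I_n./2) : D j = d j by rewrite /D valK.
have extE f (j : 'I_(n.+1./2 - 1)) : ext f j = f j by rewrite /ext valK.
have D0 j : (n./2 <= j)%N -> D j = 0 by move=> nj; rewrite /D insubF// ltnNge nj.
have [|x [y [l [l0 fxy xyE]]]] := frame_exists D0 (ext0 a) (ext0 b).
  (* If all blocks had norm zero, then [d], [a] and [b] would vanish, against the normalization. *)
  rewrite lt_neqAle sumr_ge0// andbT eq_sym; apply/eqP => /eqP.
  rewrite psumr_eq0// => /allP s0.
  have z (j : nat) : (j < n.+1./2)%N -> [/\ ext a j = 0, ext b j = 0 & D j = 0].
    move=> jN; have := s0 (Ordinal jN) (mem_index_enum _).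
    rewrite /= sqrtr_eq0 => h.
    have := sqr_ge0 (ext a j); have := sqr_ge0 (ext b j); have := sqr_ge0 (D j).
    by move=> D2 b2 a2; split; apply/eqP; rewrite -sqrf_eq0; apply/eqP; lra.
  suff : (0 : R) = 1 by move=> /eqP; rewrite eq_sym oner_eq0.
  have dz j : d j = 0 by rewrite -DE; have [|] := z j; first by have := ltn_ord j; lia.
  have az j : a j = 0 by rewrite -extE; have [|] := z j; first by have := ltn_ord j; lia.
  have bz j : b j = 0 by rewrite -extE; have [|] := z j; first by have := ltn_ord j; lia.
  rewrite -dab1 /normalized.
  under eq_bigr do rewrite dz expr0n.
  under [X in _ = _ + X]eq_bigr do rewrite az bz expr0n addr0.
  by rewrite !big1 ?addr0.
have [V [VS VE]] := stiefel_of_frame fxy.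
have Vx : entry V ord0 = x by apply/funext => i; have [] := VE i.
have Vy : entry V ord_max = y by apply/funext => i; have [] := VE i.
exists (SigSub (mem_set VS)); rewrite /stiefel_profile /= Vx Vy /frame_profile.
have dE (j : 'I_n./2) : blk_det x y j = l * d j.
  by rewrite -DE; have [|_ _ ->] := xyE j; first by have := ltn_ord j; lia.
have aE (j : 'I_(n.+1./2 - 1)) : sqr_re x y j = l * a j.
  by rewrite -(extE a); have [|-> _ _] := xyE j; first by have := ltn_ord j; lia.
have bE (j : 'I_(n.+1./2 - 1)) : sqr_im x y j = l * b j.
  by rewrite -(extE b); have [|_ -> _] := xyE j; first by have := ltn_ord j; lia.
have -> : mass n x y = l ^+ 2.
  rewrite -[RHS]mulr1 -dab1 mulrDr !mulr_sumr; congr (_ + _).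
    by apply: eq_bigr => j _; rewrite dE exprMn.
  by apply: eq_bigr => j _; rewrite aE bE; ring.
rewrite sqrtr_sqr gtr0_norm//.
have ln0 : l != 0 by rewrite gt_eqF.
by congr profile; apply/funext => j; rewrite ?dE ?aE ?bE mulrAC divff// mul1r.
Qed.

Lemma continuous_stiefel_profile u :
  continuous (fun V : Stiefel R n => stiefel_profile V u).
Proof.
have cE c i : continuous (fun V : Stiefel R n => entry (set_val V) c i).
  rewrite /entry; case: insub => [i'|]; last exact: cst_continuous.
  move=> V; apply: (@continuous_comp _ _ _ (fun V : Stiefel R n => set_val V)
    (fun M : 'M[R]_(n, 2) => M i' c)); first exact: initial_continuous.
  exact: coord_continuous.
have cS c i : continuous (fun V : Stiefel R n => entry (set_val V) c i ^+ 2).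
  exact: continuous_exprn.
have cD j : continuous (fun V : Stiefel R n =>
    blk_det (entry (set_val V) ord0) (entry (set_val V) ord_max) j).
  by apply: continuous_sub; apply: continuous_mul.
have cR j : continuous (fun V : Stiefel R n =>
    sqr_re (entry (set_val V) ord0) (entry (set_val V) ord_max) j).
  by apply: continuous_add; apply: continuous_sub.
have cI j : continuous (fun V : Stiefel R n =>
    sqr_im (entry (set_val V) ord0) (entry (set_val V) ord_max) j).
  apply: continuous_mul; first exact: cst_continuous.
  by apply: continuous_add; apply: continuous_mul.
have cM : continuous (fun V : Stiefel R n =>
    mass n (entry (set_val V) ord0) (entry (set_val V) ord_max)).
  apply: continuous_add; apply: continuous_sum => j; first exact: continuous_exprn.
  by apply: continuous_add; exact: continuous_exprn.
have M0 (V : Stiefel R n) : 0 < mass n (entry (set_val V) ord0) (entry (set_val V) ord_max).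
  by apply: mass_gt0 => //; exact: stiefel_frame.
by apply: continuous_profile => j; exact: continuous_div_sqrt.
Qed.

(** Unit columns have entries in [[-1, 1]], so the frames form a closed subset of the continuous
    image of a product of two cubes, one for each column. *)
Lemma compact_stiefel : compact [set: Stiefel R n].
Proof.
have clS : closed (@stiefel R n).
  have -> : @stiefel R n = \bigcap_(ab in [set: 'I_2 * 'I_2])
      [set V : 'M[R]_(n, 2) | \sum_(i < n) V i ab.1 * V i ab.2 = (ab.1 == ab.2)%:R].
    rewrite eqEsubset; split => V /=.
      move=> /matrixP VV [a b] _ /=; have := VV a b; rewrite !mxE => <-.
      by apply: eq_bigr => i _; rewrite mxE.
    move=> VV; apply/matrixP => a b; rewrite !mxE; have /= <- := VV (a, b) I.
    by apply: eq_bigr => i _; rewrite mxE.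
  apply: closed_bigI => -[a b] _ /=.
  apply: (preimage_closed (f := fun V : 'M[R]_(n, 2) => \sum_(i < n) V i a * V i b) (D := [set (a == b)%:R])).
    move=> V _; move: V.
    by apply: continuous_sum => i; apply: continuous_mul; exact: coord_continuous.
  exact: closed_eq.
pose box := [set v : 'rV[R]_n | forall i, `[-1, 1]%classic (v ord0 i)] `*`
  [set v : 'rV[R]_n | forall i, `[-1, 1]%classic (v ord0 i)].
have cbox : compact box by apply: compact_setX; exact: compact_box.
pose f (v : 'rV[R]_n * 'rV[R]_n) : 'M[R]_(n, 2) :=
  \matrix_(i, c) if c == ord0 then v.1 ord0 i else v.2 ord0 i.
have cf : continuous f.
  apply: continuous_mx => i c.
  have -> : (fun v => f v i c) =
      if c == ord0 then (fun v : 'rV[R]_n * 'rV[R]_n => v.1 ord0 i)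
      else (fun v : 'rV[R]_n * 'rV[R]_n => v.2 ord0 i).
    by apply/funext => v; rewrite mxE; case: ifP.
  by case: ifP => _; [exact: continuous_row1|exact: continuous_row2].
have cfb : compact (f @` box).
  by apply: continuous_compact cbox; exact: continuous_subspaceT.
have Sfb : @stiefel R n `<=` f @` box.
  move=> V /stiefelP[_ xx yy _].
  have bd (v : nat -> R) (i : 'I_n) :
      \sum_(i < n) v i ^+ 2 = 1 -> `[-1, 1]%classic (v i).
    move=> vv; apply: sqr_le1_itv; rewrite -vv (bigD1 i)//= lerDl sumr_ge0// => j _.
    exact: sqr_ge0.
  exists (\row_i V i ord0, \row_i V i ord_max).
    by split=> i; rewrite /= mxE -entryE; exact: bd.
  by apply/matrixP => i; apply/forall_ord2; rewrite !mxE.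
have -> : [set: Stiefel R n] = set_val @^-1` (@stiefel R n).
  by rewrite eqEsubset; split => // V _; exact: set_valP.
by apply: compact_set_type => //; exact: subclosed_compact clS cfb Sfb.
Qed.

Definition grass_profile : Grass2 R n -> profile_index n./2 (n.+1./2 - 1) -> R :=
  quot_lift (@stiefel_profile R n).

Lemma so2_orbit_refl (V : Stiefel R n) : so2_orbit V V.
Proof.
exists 1%:M; last by rewrite mulmx1.
by split; rewrite ?trmx1 ?mulmx1 ?det1.
Qed.

Lemma so2_orbit_mul (V W : Stiefel R n) (A : 'M[R]_2) : SO2 A ->
  set_val W = set_val V *m A -> so2_orbit W = so2_orbit V.
Proof.
move=> [AA dA] WE; apply/seteqP; split => U [B [BB dB] UE].
  exists (A *m B); last by rewrite UE WE mulmxA.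
  split; last by rewrite det_mulmx dA dB mulr1.
  by rewrite trmx_mul mulmxA -(mulmxA B^T) AA mulmx1.
have AA' := mulmx1C AA.
exists (A^T *m B); last by rewrite UE WE !mulmxA -(mulmxA _ A) AA' mulmx1.
split; last by rewrite det_mulmx det_tr dA dB mulr1.
by rewrite trmx_mul trmxK mulmxA -(mulmxA B^T) AA' mulmx1.
Qed.

Lemma so2_orbit_profile (V W : Stiefel R n) :
  so2_orbit V = so2_orbit W -> stiefel_profile V = stiefel_profile W.
Proof. by move=> VW; apply: stiefel_profile_so2; rewrite VW; exact: so2_orbit_refl. Qed.

Lemma grass_profileE (V : Stiefel R n) :
  grass_profile (qpi (@so2_orbit R n) V) = stiefel_profile V.
Proof. exact/quot_liftE/so2_orbit_profile. Qed.

(** For the converse, [stiefel_profile_inj] gives [W A = t V] with [t] in the torus. The frame [W A]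
    still represents [q], hence it witnesses the orbit relation. *)
Lemma torus_orbitP (p q : Grass2 R n) :
  torus_orbit p q <-> grass_profile p = grass_profile q.
Proof.
split.
  move=> [_ [phi _ <-] [V [W [<- <- WE]]]]; rewrite !grass_profileE.
  exact: stiefel_profile_torus WE.
have [V <-] := qpi_surj p; have [W <-] := qpi_surj q.
rewrite !grass_profileE => /(stiefel_profile_inj n0)[A [phi [AS WA]]].
have WAS : @stiefel R n (set_val W *m A).
  have [AA _] := AS; rewrite /stiefel /= trmx_mul mulmxA -(mulmxA A^T).
  by rewrite (set_valP W) mulmx1.
exists (torus_mx n phi); first by exists phi.
exists V, (SigSub (mem_set WAS)); split => //.
by apply/eq_qpi; exact: so2_orbit_mul AS _.
Qed.

Definition orbit_profile : Grass2_mod_T R n -> profile_index n./2 (n.+1./2 - 1) -> R :=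
  quot_lift grass_profile.

Lemma orbit_profileE (p : Grass2 R n) :
  orbit_profile (qpi (@torus_orbit R n) p) = grass_profile p.
Proof. by apply: quot_liftE => {}p q /(cls_eqP torus_orbitP). Qed.

Lemma orbit_profile_inj : injective orbit_profile.
Proof.
move=> p q; have [p' <-] := qpi_surj p; have [q' <-] := qpi_surj q.
by rewrite !orbit_profileE => /(cls_eqP torus_orbitP)/eq_qpi.
Qed.

Lemma continuous_orbit_profile u : continuous (fun p => orbit_profile p u).
Proof.
apply: (@continuous_quot_lift _ _ _ _ (fun p => grass_profile p u)).
  by move=> p q /(cls_eqP torus_orbitP) ->.
apply: (@continuous_quot_lift _ _ _ _ (fun V => stiefel_profile V u)).
  by move=> V W /so2_orbit_profile ->.
exact: continuous_stiefel_profile.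
Qed.

Lemma compact_Grass2_mod_T : compact [set: Grass2_mod_T R n].
Proof.
apply: (@compact_quot_by _ _ _ setT); last by move=> p; exists p.
apply: (@compact_quot_by _ _ _ setT); last by move=> V; exists V.
exact: compact_stiefel.
Qed.

Lemma orbit_profile_range p : exists d a b,
  @normalized R n./2 (n.+1./2 - 1) d a b /\ orbit_profile p = profile d a b.
Proof.
have [p' <-] := qpi_surj p; have [V <-] := qpi_surj p'.
rewrite orbit_profileE grass_profileE.
by apply: frame_profile_normalized; exact: stiefel_frame.
Qed.

Lemma orbit_profile_surj d a b : @normalized R n./2 (n.+1./2 - 1) d a b ->
  exists p, orbit_profile p = profile d a b.
Proof.
move=> /stiefel_profile_surj[V VE].
exists (qpi (@torus_orbit R n) (qpi (@so2_orbit R n) V)).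
by rewrite orbit_profileE grass_profileE.
Qed.

End grassmannian.

(** * Projective space embedded by Hermitian projectors *)

Section projective_space.
Variables (R : realType) (k m : nat).
Implicit Types z w : cnz R m.

Definition sqnorm (v : 'rV[R]_m * 'rV[R]_m) : R :=
  \sum_j (v.1 ord0 j ^+ 2 + v.2 ord0 j ^+ 2).

Lemma sqnorm_ge0 v : 0 <= sqnorm v.
Proof. by apply: sumr_ge0 => j _; rewrite addr_ge0 ?sqr_ge0. Qed.

Lemma sqnorm_eq0 v : sqnorm v = 0 -> v = (0, 0).
Proof.
move=> /eqP; rewrite psumr_eq0 => [/allP v0|j _]; last by rewrite addr_ge0 ?sqr_ge0.
have v0' j : v.1 ord0 j = 0 /\ v.2 ord0 j = 0.
  have := v0 j (mem_index_enum _).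
  by rewrite /= paddr_eq0 ?sqr_ge0// !sqrf_eq0 => /andP[/eqP -> /eqP ->].
rewrite [v]surjective_pairing; congr (_, _); apply/rowP => j; rewrite mxE.
  by have [] := v0' j.
by have [] := v0' j.
Qed.

Lemma sqnorm_gt0 z : 0 < sqnorm (set_val z).
Proof.
rewrite lt_neqAle sqnorm_ge0 andbT eq_sym; apply/eqP => /sqnorm_eq0 z0.
by have : set_val z != (0, 0) := set_valP z; rewrite z0 eqxx.
Qed.

Lemma continuous_sqnorm : continuous sqnorm.
Proof.
apply: continuous_sum => j; apply: continuous_add; apply: continuous_exprn.
  exact: continuous_row1.
exact: continuous_row2.
Qed.

(** The line of [z] is encoded by the orthogonal projector onto it, [z z^* / |z|^2], with zero real
    component. *)
Definition cnz_profile z : profile_index k m -> R :=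
  profile (fun=> 0) (fun j => (set_val z).1 ord0 j / Num.sqrt (sqnorm (set_val z)))
    (fun j => (set_val z).2 ord0 j / Num.sqrt (sqnorm (set_val z))).

(** On normalized vectors a nonzero complex scalar acts through its phase. Conversely, a phase
    between the normalized vectors becomes a scalar between [z] and [w] once multiplied by the ratio
    [l] of their norms. *)
Lemma cstar_orbitP z w : cstar_orbit z w <-> cnz_profile z = cnz_profile w.
Proof.
have nz0 (u : cnz R m) : Num.sqrt (sqnorm (set_val u)) != 0.
  by rewrite gt_eqF// sqrtr_gt0 sqnorm_gt0.
split.
  move=> [a [b [ab0 wE]]].
  have ab_gt0 : 0 < a ^+ 2 + b ^+ 2.
    rewrite lt_neqAle addr_ge0 ?sqr_ge0// andbT eq_sym paddr_eq0 ?sqr_ge0//.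
    by rewrite !sqrf_eq0 negb_and; apply/orP.
  set l := Num.sqrt (a ^+ 2 + b ^+ 2).
  have l0 : l != 0 by rewrite gt_eqF// sqrtr_gt0.
  have l2 : l ^+ 2 = a ^+ 2 + b ^+ 2 by rewrite sqr_sqrtr// ltW.
  have nE : Num.sqrt (sqnorm (set_val w)) = l * Num.sqrt (sqnorm (set_val z)).
    rewrite -sqrtrM ?ltW//; congr Num.sqrt; rewrite wE /sqnorm mulr_sumr.
    by apply: eq_bigr => j _; rewrite !mxE /=; ring.
  have cs1 : (a / l) ^+ 2 + (b / l) ^+ 2 = 1.
    by rewrite !exprMn -mulrDl exprVn l2 divff// gt_eqF.
  rewrite /cnz_profile nE -[LHS](profile_rotation _ _ _ cs1) wE.
  congr profile; apply/funext => j; rewrite !mxE /=.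
    by field; rewrite l0 nz0.
  by field; rewrite l0 nz0.
move=> /profile_inj[_ [c [s [cs1 wz]]]].
pose l := Num.sqrt (sqnorm (set_val w)) / Num.sqrt (sqnorm (set_val z)).
have l0 : l != 0 by rewrite mulf_neq0// invr_eq0.
exists (l * c), (l * s); split.
  have [c0|c0] := eqVneq c 0; last by left; rewrite mulf_neq0.
  right; rewrite mulf_neq0//; apply/eqP => s0.
  by move: cs1; rewrite c0 s0 expr0n addr0 => /eqP; rewrite eq_sym oner_eq0.
rewrite [set_val w]surjective_pairing; congr (_, _); apply/rowP => j; rewrite !mxE.
  have [+ _] := wz j; move/(canRL (mulfVK (nz0 w))) => ->.
  by rewrite /l; ring.
have [_ +] := wz j; move/(canRL (mulfVK (nz0 w))) => ->.
by rewrite /l; ring.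
Qed.

Definition proj_profile : proj_space R m -> profile_index k m -> R :=
  quot_lift cnz_profile.

Lemma proj_profileE z : proj_profile (qpi (@cstar_orbit R m) z) = cnz_profile z.
Proof. by apply: quot_liftE => z1 z2 /(cls_eqP cstar_orbitP). Qed.

Lemma proj_profile_inj : injective proj_profile.
Proof.
move=> p q; have [z <-] := qpi_surj p; have [w <-] := qpi_surj q.
by rewrite !proj_profileE => /(cls_eqP cstar_orbitP)/eq_qpi.
Qed.

Lemma continuous_proj_profile u : continuous (fun p => proj_profile p u).
Proof.
apply: (@continuous_quot_lift _ _ _ _ (fun z => cnz_profile z u)).
  by move=> z w /(cls_eqP cstar_orbitP) ->.
have cv (h : 'rV[R]_m * 'rV[R]_m -> R) : continuous h ->
    continuous (fun z : cnz R m => h (set_val z)).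
  move=> ch z; apply: (@continuous_comp _ _ _ (fun z : cnz R m => set_val z) h).
    exact: initial_continuous.
  exact: ch.
apply: continuous_profile => j; first exact: cst_continuous.
- apply: continuous_div_sqrt; first exact: sqnorm_gt0.
    exact: (cv _ (@continuous_row1 R m j)).
  exact: (cv _ continuous_sqnorm).
- apply: continuous_div_sqrt; first exact: sqnorm_gt0.
    exact: (cv _ (@continuous_row2 R m j)).
  exact: (cv _ continuous_sqnorm).
Qed.

(** Every line meets the unit sphere of C^m, which is compact and avoids zero. *)
Lemma compact_proj_space : compact [set: proj_space R m].
Proof.
have cS : compact [set v | sqnorm v = 1].
  apply: compact_level (compact_setX (@compact_box R m) (@compact_box R m)) _ _.
    exact: continuous_sqnorm.
  move=> v /= v1.
  have le1 i : v.1 ord0 i ^+ 2 + v.2 ord0 i ^+ 2 <= 1.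
    rewrite -v1 /sqnorm [leRHS](bigD1 i)//= lerDl sumr_ge0// => j _.
    by rewrite addr_ge0 ?sqr_ge0.
  by split=> i; apply: sqr_le1_itv; apply: le_trans (le1 i); rewrite ?lerDl ?lerDr sqr_ge0.
have cK : compact (set_val @^-1` [set v | sqnorm v = 1] : set (cnz R m)).
  apply: compact_set_type => // v /= v1; apply/eqP => v0; move: v1.
  rewrite v0 /sqnorm big1 => [/eqP|j _]; first by rewrite eq_sym oner_eq0.
  by rewrite !mxE expr0n addr0.
apply: compact_quot_by cK _.
move=> z; set l := (Num.sqrt (sqnorm (set_val z)))^-1.
have l0 : l != 0 by rewrite invr_eq0 gt_eqF// sqrtr_gt0 sqnorm_gt0.
have l2 : l ^+ 2 * sqnorm (set_val z) = 1.
  by rewrite exprVn sqr_sqrtr ?sqnorm_ge0// mulVf// gt_eqF// sqnorm_gt0.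
pose w : 'rV[R]_m * 'rV[R]_m := (l *: (set_val z).1, l *: (set_val z).2).
have w1 : sqnorm w = 1.
  rewrite -l2 /sqnorm mulr_sumr; apply: eq_bigr => j _; rewrite !mxE /=; ring.
have w0 : w \in [set z : 'rV[R]_m * 'rV[R]_m | z != (0, 0)].
  rewrite inE /=; apply/eqP => e; move: w1; rewrite e /sqnorm big1 => [/eqP|j _].
    by rewrite eq_sym oner_eq0.
  by rewrite !mxE expr0n addr0.
exists (SigSub w0) => //.
apply/esym/(cls_eqP cstar_orbitP)/cstar_orbitP; exists l, 0.
by split; [left|rewrite !scale0r subr0 addr0].
Qed.

End projective_space.

#[local] Arguments proj_profile : simpl never.

(** * The join and its embedding *)

Section join_profile.
Variables (R : realType) (k m : nat).
Local Notation Sph := (unit_sphere R k).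
Local Notation Proj := (proj_space R m).
Implicit Types p q : (Sph * Proj) * unit_interval R.

(** A triple [(s, [z], t)] is sent to the profile of [d = t s] and [p = sqrt (1 - t^2) z / |z|], for
    which [|d|^2 + |p|^2 = 1]. *)
Definition join_profile_pre p (u : profile_index k m) : R :=
  match u with
  | inl j => set_val p.2 * (set_val p.1.1 : 'rV[R]_k) ord0 j
  | inr v => (1 - set_val p.2 ^+ 2) * proj_profile p.1.2 (inr v : profile_index k m)
  end.

Lemma proj_profile_inl (x : Proj) j : proj_profile x (inl j : profile_index k m) = 0.
Proof. by have [z <-] := qpi_surj x; rewrite proj_profileE. Qed.

Lemma join_profile_pre_time p : \sum_j join_profile_pre p (inl j) ^+ 2 = set_val p.2 ^+ 2.
Proof.
rewrite /=; under eq_bigr do rewrite exprMn.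
by rewrite -mulr_sumr (set_valP p.1.1) mulr1.
Qed.

(** The parameter [t] is the length of the real component. The point of the sphere can then be
    recovered unless [t = 0], and the point of projective space unless [t = 1], which are exactly
    the identifications of the join. *)
Lemma join_classP p q : join_class p q <-> join_profile_pre p = join_profile_pre q.
Proof.
have t01 (t : unit_interval R) : 0 <= set_val t <= 1 by exact: (set_valP t).
have tE p1 q1 : join_profile_pre p1 = join_profile_pre q1 -> set_val p1.2 = set_val q1.2.
  move=> e; have : set_val p1.2 ^+ 2 = set_val q1.2 ^+ 2.
    by rewrite -!join_profile_pre_time e.
  have /andP[p0 _] := t01 p1.2; have /andP[q0 _] := t01 q1.2.
  by move=> /eqP; rewrite eqrXn2// => /eqP.
have projE p1 q1 : set_val p1.2 < 1 -> join_profile_pre p1 = join_profile_pre q1 ->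
    p1.1.2 = q1.1.2.
  move=> p11 e; apply: (@proj_profile_inj R k m).
  apply/funext => -[j|v]; first by rewrite !proj_profile_inl.
  have /= := congr1 (@^~ (inr v)) e; rewrite -(tE _ _ e) => /mulfI; apply.
  have /andP[p0 _] := t01 p1.2.
  by rewrite subr_eq0 eq_sym lt_eqF// expr_lt1.
have sphE p1 q1 : set_val p1.2 != 0 -> join_profile_pre p1 = join_profile_pre q1 ->
    p1.1.1 = q1.1.1.
  move=> p10 e; apply/val_inj/rowP => j.
  by have /= := congr1 (@^~ (inl j)) e; rewrite -(tE _ _ e) => /mulfI; exact.
rewrite /join_class; have [p0|p0] := eqVneq (set_val p.2) 0.
  split => [[pq q0]|e].
    by apply/funext => -[j|v] /=; rewrite p0 q0 ?mul0r// pq.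
  split; last by rewrite -(tE _ _ e).
  by apply/esym/projE => //; rewrite p0.
have [p1|p1] := eqVneq (set_val p.2) 1.
  split => [[pq q1]|e].
    by apply/funext => -[j|v] /=; rewrite p1 q1 ?expr1n ?subrr ?mul0r// pq.
  split; last by rewrite -(tE _ _ e).
  exact/esym/sphE.
split => [->//|e].
case: p q e p0 p1 => [[p1 p2] p3] [[q1 q2] q3] e p30 p31.
have -> : q3 = p3 by apply/val_inj/esym/(tE _ _ e).
have -> : q1 = p1 by apply/esym/(sphE _ _ _ e).
have -> // : q2 = p2.
apply/esym/(projE _ _ _ e); rewrite lt_neqAle p31.
by have /andP[] := t01 p3.
Qed.

Definition join_profile : join R Sph Proj -> profile_index k m -> R :=
  quot_lift join_profile_pre.

Lemma join_profileE p : join_profile (qpi (@join_class R Sph Proj) p) = join_profile_pre p.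
Proof. by apply: quot_liftE => {}p q /(cls_eqP join_classP). Qed.

Lemma join_profile_inj : injective join_profile.
Proof.
move=> x y; have [p <-] := qpi_surj x; have [q <-] := qpi_surj y.
by rewrite !join_profileE => /(cls_eqP join_classP)/eq_qpi.
Qed.

Lemma continuous_join_profile u : continuous (fun x => join_profile x u).
Proof.
apply: (@continuous_quot_lift _ _ _ _ (fun p => join_profile_pre p u)).
  by move=> p q /(cls_eqP join_classP) ->.
have ct : continuous (fun p : (Sph * Proj) * unit_interval R => set_val p.2 : R).
  move=> p; apply: (@continuous_comp _ _ _ snd (fun t : unit_interval R => set_val t)).
    exact: cvg_snd.
  exact: initial_continuous.
have c1 : continuous (fun p : (Sph * Proj) * unit_interval R => p.1.1).
  by move=> p; apply: (@continuous_comp _ _ _ fst fst); exact: cvg_fst.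
have c2 : continuous (fun p : (Sph * Proj) * unit_interval R => p.1.2).
  by move=> p; apply: (@continuous_comp _ _ _ fst snd); [exact: cvg_fst|exact: cvg_snd].
case: u => [j|v] /=.
  apply: (continuous_mul ct) => p.
  apply: (@continuous_comp _ _ _ (fun p : (Sph * Proj) * unit_interval R => p.1.1)
    (fun s : Sph => (set_val s : 'rV[R]_k) ord0 j)); first exact: c1.
  exact: continuous_unit_sphere.
have cu : continuous (fun p : (Sph * Proj) * unit_interval R => 1 - set_val p.2 ^+ 2 : R).
  by apply: continuous_sub; [exact: cst_continuous|exact: continuous_exprn].
have cq : continuous (fun p : (Sph * Proj) * unit_interval R =>
    proj_profile p.1.2 (inr v : profile_index k m)).
  move=> p; apply: (@continuous_comp _ _ _ (fun p : (Sph * Proj) * unit_interval R => p.1.2)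
    (fun x : Proj => proj_profile x (inr v : profile_index k m))); first exact: c2.
  exact: continuous_proj_profile.
exact: (continuous_mul cu cq).
Qed.

Lemma compact_join : compact [set: join R Sph Proj].
Proof.
apply: (@compact_quot_by _ _ _ setT); last by move=> p; exists p.
have -> : [set: (Sph * Proj) * unit_interval R] = ([set: Sph] `*` [set: Proj]) `*` setT.
  by rewrite !setXTT.
apply: compact_setX; first apply: compact_setX.
- exact: compact_unit_sphere.
- exact: compact_proj_space.
rewrite (_ : setT = set_val @^-1` [set t : R | 0 <= t <= 1]).
  apply: compact_set_type => //.
  rewrite (_ : [set t | _] = `[0, 1]%classic); first exact: segment_compact.
  by apply/seteqP; split => t /=; rewrite in_itv.
by rewrite eqEsubset; split => // t _; exact: set_valP.
Qed.

Lemma join_profile_range x : exists d a b,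
  @normalized R k m d a b /\ join_profile x = profile d a b.
Proof.
have [[[s p] t] <-] := qpi_surj x; have [z zp] := qpi_surj p.
rewrite join_profileE.
have /andP[t0 t1] : 0 <= set_val t <= 1 by exact: (set_valP t).
have t2 : 0 <= 1 - set_val t ^+ 2 by rewrite subr_ge0 expr_le1.
set l := Num.sqrt (1 - set_val t ^+ 2); set N := Num.sqrt (sqnorm (set_val z)).
have l2 : l ^+ 2 = 1 - set_val t ^+ 2 by rewrite sqr_sqrtr.
have N2 : N ^+ 2 = sqnorm (set_val z) by rewrite sqr_sqrtr// sqnorm_ge0.
have N0 : N != 0 by rewrite gt_eqF// sqrtr_gt0 sqnorm_gt0.
exists (fun j => set_val t * (set_val s : 'rV[R]_k) ord0 j),
  (fun j => l * ((set_val z).1 ord0 j / N)), (fun j => l * ((set_val z).2 ord0 j / N)).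
split; last first.
  have zpE : @proj_profile R k m p = cnz_profile z by rewrite -zp proj_profileE.
  apply/funext => -[//|[[c i] j]] /=.
  by rewrite zpE /cnz_profile -/N /= -l2; case: c; ring.
rewrite /normalized.
under eq_bigr do rewrite exprMn.
rewrite -mulr_sumr (set_valP s) mulr1.
have -> : \sum_j ((l * ((set_val z).1 ord0 j / N)) ^+ 2 +
    (l * ((set_val z).2 ord0 j / N)) ^+ 2) = l ^+ 2 / N ^+ 2 * sqnorm (set_val z).
  by rewrite mulr_sumr; apply: eq_bigr => j _; field.
by rewrite -N2 divfK ?expf_neq0// l2; ring.
Qed.

(** Take [t = |d|], the direction of [d] and the line of [a + 'i b]. When [d] or [a + 'i b] is zero,
    any point of the corresponding factor will do, and positivity of [k] and [m] provides one. *)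
Lemma join_profile_surj d a b : (0 < k)%N -> (0 < m)%N -> @normalized R k m d a b ->
  exists x, join_profile x = profile d a b.
Proof.
move=> k0 m0 dab1.
pose D := \sum_j d j ^+ 2; pose E := \sum_j (a j ^+ 2 + b j ^+ 2).
have D0 : 0 <= D by apply: sumr_ge0 => j _; exact: sqr_ge0.
have E0 : 0 <= E by apply: sumr_ge0 => j _; rewrite addr_ge0 ?sqr_ge0.
have DE : D + E = 1 by [].
pose t := Num.sqrt D; have t2 : t ^+ 2 = D by rewrite sqr_sqrtr.
have t01 : t \in [set t : R | 0 <= t <= 1].
  by rewrite inE /= sqrtr_ge0 -(@expr_le1 _ 2) ?sqrtr_ge0// t2 -DE lerDl.
have [s sP] : exists s : Sph, forall j, t * (set_val s : 'rV[R]_k) ord0 j = d j.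
  have [t0|t0] := eqVneq t 0.
    have e1 : \row_(j < k) (j == Ordinal k0)%:R \in
        [set x : 'rV[R]_k | \sum_(i < k) x ord0 i ^+ 2 = 1].
      rewrite inE /= (bigD1 (Ordinal k0))//= mxE eqxx expr1n big1 ?addr0// => j /negPf jk.
      by rewrite mxE jk expr0n.
    exists (SigSub e1) => j; rewrite t0 mul0r.
    move/eqP : t2; rewrite t0 expr0n eq_sym psumr_eq0 => [/allP d0|i _]; last exact: sqr_ge0.
    by have := d0 j (mem_index_enum _); rewrite /= sqrf_eq0 => /eqP ->.
  have e1 : \row_j (d j / t) \in [set x : 'rV[R]_k | \sum_(i < k) x ord0 i ^+ 2 = 1].
    rewrite inE /=; under eq_bigr do rewrite mxE exprMn.
    by rewrite -mulr_suml -/D -t2 -exprMn divff// expr1n.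
  by exists (SigSub e1) => j; rewrite /= mxE mulrC divfK.
have [p pP] : exists p : Proj, forall v, (1 - t ^+ 2) *
    proj_profile p (inr v : profile_index k m) = profile d a b (inr v).
  have tE : 1 - t ^+ 2 = E by rewrite t2 -DE; ring.
  rewrite tE; have [E00|E00] := eqVneq E 0.
    have z0 : ((\row_(j < m) 1, 0) : 'rV[R]_m * 'rV[R]_m) \in
        [set z : 'rV[R]_m * 'rV[R]_m | z != (0, 0)].
      rewrite inE /=; apply/eqP => -[/rowP/(_ (Ordinal m0))]; rewrite !mxE => /eqP.
      by rewrite oner_eq0.
    exists (qpi (@cstar_orbit R m) (SigSub z0)) => v; rewrite E00 mul0r.
    have ab0 j : a j = 0 /\ b j = 0.
      move/eqP : E00; rewrite psumr_eq0 => [/allP h|i _]; last by rewrite addr_ge0 ?sqr_ge0.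
      have := h j (mem_index_enum _).
      by rewrite /= paddr_eq0 ?sqr_ge0// !sqrf_eq0 => /andP[/eqP -> /eqP ->].
    case: v => [[c i] j] /=; have [-> ->] := ab0 i; have [-> ->] := ab0 j.
    by case: c; ring.
  have z0 : (\row_j a j, \row_j b j) \in [set z : 'rV[R]_m * 'rV[R]_m | z != (0, 0)].
    rewrite inE /=; apply/eqP => -[/rowP a0 /rowP b0]; move/eqP : E00; apply.
    rewrite /E big1// => j _; have := a0 j; have := b0 j; rewrite !mxE => -> ->.
    by rewrite expr0n addr0.
  exists (qpi (@cstar_orbit R m) (SigSub z0)) => v; rewrite proj_profileE /cnz_profile /=.
  have -> : sqnorm (\row_j a j, \row_j b j) = E.
    by apply: eq_bigr => j _; rewrite !mxE.
  set N := Num.sqrt E; have N0 : N != 0 by rewrite gt_eqF// sqrtr_gt0 lt_neqAle eq_sym E00.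
  have -> : E = N ^+ 2 by rewrite sqr_sqrtr.
  by case: v => [[c i] j] /=; rewrite !mxE; case: c; field.
exists (qpi (@join_class R Sph Proj) (s, p, SigSub t01)).
rewrite join_profileE; apply/funext => -[j|v] /=; [exact: sP|exact: pP].
Qed.

End join_profile.

(** * Comparison of the two images *)

Lemma homeomorphic_join (R : realType) (n : nat) : (2 < n)%N ->
  homeomorphic (Grass2_mod_T R n)
    (join R (unit_sphere R n./2) (proj_space R ((n.+1)./2 - 1))).
Proof.
move=> n2; have n0 : (0 < n)%N by lia.
apply: (@homeomorphic_of_invariants R (profile_index n./2 (n.+1./2 - 1)) _ _
  (fun u x => orbit_profile x u) (fun u y => join_profile y u)).
- exact: Rhausdorff.
- exact: compact_Grass2_mod_T.
- exact: compact_join.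
- by move=> u; exact: continuous_orbit_profile.
- by move=> u; exact: continuous_join_profile.
- by move=> x x' e; apply: (orbit_profile_inj n0); exact/funext.
- by move=> y y' e; apply: join_profile_inj; exact/funext.
- move=> x; have [d [a [b [dab ->]]]] := orbit_profile_range n0 x.
  (* From [2 < n] both [n./2] and [n.+1./2 - 1] are positive, so neither factor of the join is
     empty. *)
  by have [||y yE] := join_profile_surj _ _ dab; [lia|lia|exists y => u; rewrite yE].
- move=> y; have [d [a [b [dab ->]]]] := join_profile_range y.
  by have [x xE] := orbit_profile_surj n0 dab; exists x => u; rewrite xE.
Qed.

(** For [n = 2] the only [p] is zero by the linear relation. The profile reduces to one real number
    [d] with [d^2 = 1], a point of S^0. *)
Lemma homeomorphic_sphere (R : realType) :
  homeomorphic (Grass2_mod_T R 2) (unit_sphere R 1).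
Proof.
pose G (s : unit_sphere R 1) : profile_index 1 0 -> R :=
  profile (fun j => (set_val s : 'rV[R]_1) ord0 j) (fun=> 0) (fun=> 0).
have ab0 (a : 'I_0 -> R) : a = (fun=> 0) by apply/funext => -[].
apply: (@homeomorphic_of_invariants R (profile_index 1 0) _ _
  (fun u (x : Grass2_mod_T R 2) => orbit_profile x u) (fun u y => G y u)).
- exact: Rhausdorff.
- exact: compact_Grass2_mod_T.
- exact: compact_unit_sphere.
- by move=> u; exact: continuous_orbit_profile.
- move=> u; apply: continuous_profile => j; try exact: cst_continuous.
  exact: continuous_unit_sphere.
- by move=> x x' e; apply: (@orbit_profile_inj R 2) => //; exact/funext.
- by move=> y y' e; apply/val_inj/rowP => j; exact: e (inl j).
- move=> x; have [d [a [b [dab ->]]]] := @orbit_profile_range R 2 isT x.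
  move: dab; rewrite /normalized [X in _ + X]big_ord0 addr0 => d1.
  have s1 : \row_j d j \in [set x : 'rV[R]_1 | \sum_(i < 1) x ord0 i ^+ 2 = 1].
    by rewrite inE /= -d1; apply: eq_bigr => j _; rewrite mxE.
  exists (SigSub s1) => u; rewrite /G (ab0 a) (ab0 b); congr (profile _ _ _ u).
  by apply/funext => j; rewrite mxE.
- move=> s; have [|x xE] := @orbit_profile_surj R 2 isT
      (fun j => (set_val s : 'rV[R]_1) ord0 j) (fun=> 0) (fun=> 0).
    by rewrite /normalized [X in _ + X]big_ord0 addr0; exact: (set_valP s).
  by exists x => u; rewrite xE.
Qed.

(* G^+_R(2,n)/T is homeomorphic to S^(floor(n/2)-1) * P_C^(ceil(n/2)-2);
   for n = 2, P_C^(-1) is empty and the join is S^0 itself. *)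
Theorem theorem1p1 (R : realType) (n : nat) : (2 <= n)%N ->
  if n == 2%N then homeomorphic (Grass2_mod_T R n) (unit_sphere R n./2)
  else homeomorphic (Grass2_mod_T R n)
         (join R (unit_sphere R n./2) (proj_space R ((n.+1)./2 - 1))).
Proof.
move=> n2; have [->|nn2] := eqVneq n 2%N; first exact: homeomorphic_sphere.
by apply: homeomorphic_join; lia.
Qed.
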